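(* Let $G$ be a connected accessible graph and let $B$ be a block of $G$. Let $W=\{w_1,\dots,w_r\}$ be the set of cutpoints of $G$ that are vertices of $B$, and let $\overline{B}$ be the graph with $V(\overline{B})=V(B)\cup\{f_1,\dots,f_r\}$, where $f_1,\dots,f_r$ are new distinct vertices, and $E(\overline{B})=E(B)\cup\{\{w_i,f_i\} : i=1,\dots,r\}$. Then $\overline{B}$ is accessible.
   Context: All graphs are finite and simple. For a graph $G$ and $T\subseteq V(G)$, $G\setminus T$ is the induced subgraph on $V(G)\setminus T$ and $c_G(T)$ is the number of its connected components. $T$ is a cutset of $G$ if $c_G(T\setminus\{v\})<c_G(T)$ for every $v\in T$; $\mathcal{C}(G)$ is the set of all cutsets (so $\emptyset\in\mathcal{C}(G)$). A vertex $v$ is a cutpoint if $\{v\}\in\mathcal{C}(G)$. A block of $G$ is a connected induced subgraph of $G$ that has no cutpoint and is maximal with respect to this property. Let $\mathbb{K}$ be a field, label the vertices of $G$ by $[n]$, and let $S=\mathbb{K}[x_1,\dots,x_n,y_1,\dots,y_n]$. The binomial edge ideal is $J_G=(x_iy_j-x_jy_i : i<j,\ \{i,j\}\in E(G))\subseteq S$. $J_G$ is unmixed if all its minimal primes have the same height ($J_G$ is a radical ideal). $G$ is accessible if $J_G$ is unmixed and for every non-empty $T\in\mathcal{C}(G)$ there is $t\in T$ with $T\setminus\{t\}\in\mathcal{C}(G)$. *)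

(* Defs.v *)
From HB Require Import structures.
From mathcomp Require Import all_boot all_order all_algebra.
From mathcomp Require Import classical_sets.
From mathcomp Require Import ring_quotient.

Set Implicit Arguments.
Unset Strict Implicit.
Unset Printing Implicit Defensive.

Import GRing.Theory.
Local Open Scope ring_scope.

Record sgraph := SGraph {
  svertex :> finType;
  sedge : rel svertex;
  sedge_sym : symmetric sedge;
  sedge_irrefl : irreflexive sedge }.

Section Graphs.

Implicit Types G : sgraph.

Section Induced.
Variables (G : sgraph) (A : {set G}).

Definition induced_vertex : finType := {x : G | x \in A}.

Definition induced_edge : rel induced_vertex :=
  [rel x y | sedge (val x) (val y)].

Lemma induced_edge_sym : symmetric induced_edge.
Proof. by move=> x y; apply: sedge_sym. Qed.

Lemma induced_edge_irrefl : irreflexive induced_edge.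
Proof. by move=> x; apply: sedge_irrefl. Qed.

Definition induced : sgraph := SGraph induced_edge_sym induced_edge_irrefl.
End Induced.

Definition ncomponents G : nat := n_comp (@sedge G) predT.

(* In particular the graph with no vertex is not connected. *)
Definition connected G : bool := ncomponents G == 1%N.

Definition c_del G (T : {set G}) : nat := ncomponents (induced (~: T)).

Definition cutset G (T : {set G}) : bool :=
  [forall v in T, (c_del (T :\ v) < c_del T)%N].

Definition cutpoint G (v : G) : bool := cutset [set v].

(* Having no cutpoint refers to the cutpoints of the induced subgraph, not to
   those of [G]. *)
Definition block G (B : {set G}) : bool :=
  maxset [pred A : {set G} | connected (induced A) &&
                             [forall v : induced A, ~~ cutpoint v]] B.

Definition block_cutpoints G (B : {set G}) : {set G} :=
  [set w in B | cutpoint w].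

Section Bar.
Variables (G : sgraph) (B : {set G}).

(* [inr w] is the new vertex f_w attached to the cutpoint w. *)
Definition bar_vertex : finType :=
  (induced B + {w : G | w \in block_cutpoints B})%type.

Definition bar_edge : rel bar_vertex := fun p q =>
  match p, q with
  | inl x, inl y => sedge x y
  | inl x, inr w => val x == val w
  | inr w, inl x => val x == val w
  | inr _, inr _ => false
  end.

Lemma bar_edge_sym : symmetric bar_edge.
Proof. by move=> [x|w] [y|z] //=; apply: sedge_sym. Qed.

Lemma bar_edge_irrefl : irreflexive bar_edge.
Proof. by move=> [x|w] //=; apply: sedge_irrefl. Qed.

Definition bar : sgraph := SGraph bar_edge_sym bar_edge_irrefl.
End Bar.

End Graphs.

Section Ideals.
Local Open Scope classical_set_scope.
Variable R : comNzRingType.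
Implicit Types I P Q : set R.

(* [idealr_closed] includes properness. *)
Definition prime_ideal P : Prop :=
  idealr_closed [in P] /\ prime_idealr_closed [in P].

Definition minimal_prime I P : Prop :=
  [/\ prime_ideal P, I `<=` P &
      forall Q, prime_ideal Q -> I `<=` Q -> Q `<=` P -> Q = P].

Definition prime_chain P (h : nat) : Prop :=
  exists c : nat -> set R,
    [/\ c h = P, forall i, (i <= h)%N -> prime_ideal (c i) &
        forall i, (i < h)%N -> c i `<` c i.+1].

Definition has_height P (h : nat) : Prop :=
  prime_chain P h /\ forall m, prime_chain P m -> (m <= h)%N.

(* A prime that has no [has_height] value has infinite height, so the
   equivalence below is equality of heights in all cases. *)
Definition unmixed I : Prop :=
  forall P Q, minimal_prime I P -> minimal_prime I Q ->
    forall h, has_height P h <-> has_height Q h.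

End Ideals.

(* Imported only here: mpoly shadows [symmetric]. *)
From mathcomp Require Import mpoly.

Section BinomialEdgeIdeal.
Variables (K : fieldType) (G : sgraph).

(* The vertices of [G] are labelled by [enum_rank]; the first #|G| variables
   are the x's and the last #|G| are the y's. *)
Definition bei_ring := {mpoly K[#|G| + #|G|]}.

Definition bei_x (v : G) : bei_ring := 'X_(lshift #|G| (enum_rank v)).
Definition bei_y (v : G) : bei_ring := 'X_(rshift #|G| (enum_rank v)).

Definition edge_binomial (v w : G) : bei_ring :=
  bei_x v * bei_y w - bei_x w * bei_y v.

Definition binomial_edge_ideal : set bei_ring :=
  [set f | exists a : G -> G -> bei_ring,
     f = \sum_(v : G) \sum_(w : G | sedge v w && (enum_rank v < enum_rank w)%N)
           a v w * edge_binomial v w]%classic.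

Definition accessible : Prop :=
  unmixed binomial_edge_ideal /\
  forall T : {set G}, cutset T -> T != finset.set0 ->
    exists2 t, t \in T & cutset (T :\ t).

End BinomialEdgeIdeal.

(* Main.v *)
Require Import Defs.
From mathcomp Require Import all_boot all_algebra.
From HB Require Import structures.

(** Over a field, the minimal primes of [J_G] are the kernels [P_T], for [T] a
    cutset, of the parametrizations sending [x_v], [y_v] to [u_v s_c], [u_v r_c]
    with [c] the component of [v] in [G \ T] (and to [0] if [v] is in [T]): a prime
    containing [J_G] is the kernel of a map to a field, and the columns
    [(x_v, y_v)] with [v] in one component that are not killed become
    proportional there.  Each [P_T] lies on an explicit chain of primes of length
    [2n], while no chain of primes in [2n] variables is longer, so [P_T] has height
    [n + |T| - c(T)] and [J_G] is unmixed iff [c(T) = |T| + c(0)] for all cutsets.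

    A vertex outside the block [B] reaches [B] through a single vertex of [B], its
    gate, since an ear of [B] would contradict maximality.  Gates are exactly the
    cutpoints of [G] in [B], and as [G \ w] has only two components, the vertices
    with gate [w] form one connected piece.  Hence [bar B] is obtained from [G] by
    contracting each of these pieces to a leaf, which preserves the number of
    components after deleting any set of vertices of [B]; and cutsets of [bar B]
    contain no leaf. *)

Set Implicit Arguments.
Unset Strict Implicit.
Unset Printing Implicit Defensive.

(** * Connectivity and cutsets *)

Section Connectivity.
Variable G : sgraph.
Implicit Types (A T : {set G}) (u v w x y : G).

(** Subgraphs induced on different sets stay relations on the one type [G], so their connectivity
    can be compared directly. A vertex outside [A] is isolated. *)
Definition erel A : rel G := [rel x y | [&& x \in A, y \in A & sedge x y]].
Definition conn A : rel G := connect (erel A).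

Lemma erel_sym A : ssrbool.symmetric (erel A).
Proof. by move=> x y; rewrite /erel /= sedge_sym; case: (x \in A); case: (y \in A). Qed.

Lemma conn_csym A : connect_sym (erel A).
Proof. exact/sym_connect_sym/erel_sym. Qed.

Lemma conn_sym A : ssrbool.symmetric (conn A).
Proof. exact: conn_csym. Qed.

Lemma conn_refl A x : conn A x x. Proof. exact: connect0. Qed.

Lemma conn_trans A : transitive (conn A). Proof. exact: connect_trans. Qed.

Lemma conn_edge A x y : x \in A -> y \in A -> sedge x y -> conn A x y.
Proof. by move=> xA yA xy; apply: connect1; rewrite /erel /= xA yA. Qed.

(** Induction along a path. Preservation in one direction is enough because the relation is
    symmetric. *)
Lemma erel_closed A (P : {pred G}) :
  (forall x y, x \in A -> y \in A -> sedge x y -> x \in P -> y \in P) ->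
  forall x y, conn A x y -> x \in P -> y \in P.
Proof.
move=> PE x y xy; suff cP : closed (erel A) P by rewrite (closed_connect cP xy).
by apply: (intro_closed (@conn_csym A)) => u v /and3P[]; apply: PE.
Qed.

Lemma conn_mem A x y : conn A x y -> x \in A -> y \in A.
Proof. by apply: erel_closed. Qed.

Lemma conn_sub A A' x y : A \subset A' -> conn A x y -> conn A' x y.
Proof.
move=> sAA'; apply: connect_sub => u v /= /and3P[uA vA uv].
by apply: conn_edge => //; apply: (subsetP sAA').
Qed.

Definition ccroot A v : G := fingraph.root (erel A) v.

Lemma ccrootP A u v : reflect (ccroot A u = ccroot A v) (conn A u v).
Proof. exact: (fingraph.rootP (@conn_csym A)). Qed.

Lemma ccroot_conn A v : conn A v (ccroot A v).
Proof. exact: connect_root. Qed.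

Lemma ccroot_mem A v : v \in A -> ccroot A v \in A.
Proof. exact: conn_mem (ccroot_conn A v). Qed.

Lemma ccrootK A v : ccroot A (ccroot A v) = ccroot A v.
Proof. exact: (root_root (@conn_csym A)). Qed.

Definition ccroots A : {set G} := [set v in A | ccroot A v == v].

Lemma ccroots_root A v : v \in A -> ccroot A v \in ccroots A.
Proof. by move=> vA; rewrite inE ccroot_mem //= ccrootK. Qed.

Lemma ccroots_conn A u v : u \in ccroots A -> v \in ccroots A -> conn A u v -> u = v.
Proof. by rewrite !inE => /andP[_ /eqP ru] /andP[_ /eqP rv] /ccrootP; rewrite ru rv. Qed.

Lemma n_comp_ccroots A : n_comp (erel A) A = #|ccroots A|.
Proof. by apply: eq_card => v; rewrite !inE andbC. Qed.

(** A path through [v] can be rerouted inside [A], since the neighbours it uses before and after [v]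
    are already connected there. *)
Lemma conn_setU1 A v x y : v \notin A ->
  (forall u w, u \in A -> w \in A -> sedge v u -> sedge v w -> conn A u w) ->
  x \in A -> y \in A -> conn (v |: A) x y -> conn A x y.
Proof.
(* At [v] itself the invariant records that some neighbour of [v] has been reached inside [A]. *)
move=> vA vnb xA yA xy; pose P := [pred z | if z == v
  then [exists u, [&& u \in A, sedge v u & conn A x u]] else conn A x z].
have: y \in P; last by rewrite inE; case: eqP => // yv; rewrite -yv yA in vA.
apply: (erel_closed _ xy); last first.
  by rewrite inE conn_refl; case: eqP => // xv; rewrite -xv xA in vA.
move=> a b; rewrite !in_setU1 => aA bA ab; rewrite !inE.
case: eqP aA => [av _|_ /= aA]; case: eqP bA => [bv _|_ /= bA] //.
- move=> /existsP[u /and3P[uA vu xu]]; apply: conn_trans xu _.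
  by apply: vnb => //; rewrite -av.
- move=> xa; apply/existsP; exists a; rewrite aA xa andbT /= -bv.
  by rewrite sedge_sym.
by move=> xa; apply: conn_trans xa (conn_edge _ _ _).
Qed.

(** Adding [v] merges the components that contain its neighbours, so the count drops exactly when
    there are at least two of them. *)
Lemma ccroots_lt A v : v \notin A ->
  (#|ccroots (v |: A)| < #|ccroots A|)%N <->
  exists u w, [/\ u \in A, w \in A, sedge v u, sedge v w & ~~ conn A u w].
Proof.
move=> vA; have sA : A \subset v |: A by apply: subsetUr.
have rP u : u \in A -> ccroot (v |: A) u \in ccroots (v |: A).
  by move=> uA; rewrite ccroots_root // (subsetP sA).
split=> [lt|[u [w [uA wA vu vw nuw]]]]; last first.
  have vuA : conn (v |: A) v u by apply: conn_edge; rewrite ?setU11 ?(subsetP sA).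
  have vwA : conn (v |: A) v w by apply: conn_edge; rewrite ?setU11 ?(subsetP sA).
  (* Every component of [v |: A] contains a vertex of [A] not connected to [u] in [A]: for the
     component of [v] it is [w], for any other its root. So the root of [u] can be spared. *)
  have sub : ccroots (v |: A) \subset ccroot (v |: A) @: (ccroots A :\ ccroot A u).
    apply/subsetP => r /[dup] rR; rewrite inE => /andP[rA /eqP rr].
    suff [t tA [tr tu]] : exists2 t, t \in A & conn (v |: A) t r /\ ~~ conn A t u.
      apply/imsetP; exists (ccroot A t).
        rewrite !inE ccroot_mem // ccrootK eqxx !andbT.
        by apply: contra tu => /eqP/ccrootP.
      rewrite -[LHS]rr; apply/ccrootP; rewrite conn_sym; apply: conn_trans tr.
      by rewrite conn_sym; apply: conn_sub sA _; apply: ccroot_conn.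
    have [rv|nrv] := boolP (conn (v |: A) r v).
      exists w => //; split; last by rewrite conn_sym.
      by rewrite conn_sym; apply: conn_trans rv vwA.
    have rA' : r \in A.
      by move: rA; rewrite in_setU1 => /orP[/eqP rv|//]; rewrite rv conn_refl in nrv.
    exists r => //; split; first exact: conn_refl.
    apply: contra nrv => /(conn_sub sA) ru; apply: conn_trans ru _.
    by rewrite conn_sym.
  apply: leq_ltn_trans (subset_leq_card sub) _.
  apply: leq_ltn_trans (leq_imset_card _ _) _.
  by rewrite [X in (_ < X)%N](cardsD1 (ccroot A u)) ccroots_root.
case: (pickP [pred p : G * G | [&& p.1 \in A, p.2 \in A, sedge v p.1, sedge v p.2
   & ~~ conn A p.1 p.2]]) => [[u w] /and5P[*]|none]; first by exists u, w.
have vnb u w : u \in A -> w \in A -> sedge v u -> sedge v w -> conn A u w.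
  by move=> uA wA vu vw; move: (none (u, w)); rewrite /= uA wA vu vw => /negbFE.
have cA x y : x \in A -> y \in A -> conn (v |: A) x y -> conn A x y.
  exact: conn_setU1.
(* Otherwise adding [v] connects no two components of [A], and distinct roots of [A] have distinct
   roots in [v |: A]. *)
move: lt; rewrite ltnNge => /negP[].
rewrite -(card_in_imset (f := ccroot (v |: A)) (D := mem (ccroots A))).
  apply/subset_leq_card/subsetP => _ /imsetP[r rR ->].
  by apply: rP; move: rR; rewrite inE => /andP[].
move=> a b aR bR /ccrootP ab; apply: (@ccroots_conn A) => //.
by apply: cA => //; [move: aR|move: bR]; rewrite inE => /andP[].
Qed.

Lemma induced_adjunction A :
  rel_adjunction (fun v : induced A => val v) (erel A) (@sedge (induced A)) A.
Proof.
have csym : connect_sym (@sedge (induced A)).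
  exact/sym_connect_sym/sedge_sym.
apply: (strict_adjunction csym).
- by apply: (intro_closed (@conn_csym A)) => x y /and3P[].
- exact: val_inj.
- apply/subsetP => x xA; apply/codomP.
  by exists (exist _ x xA : induced A).
- by move=> [x xA] [y yA] _; rewrite /erel /= xA yA.
Qed.

Lemma c_delE T : c_del T = #|ccroots (~: T)|.
Proof.
have csym : connect_sym (@sedge (induced (~: T))) by exact/sym_connect_sym/sedge_sym.
have clT : closed (erel (~: T)) (~: T).
  by apply: (intro_closed (@conn_csym _)) => x y /and3P[].
rewrite -n_comp_ccroots.
rewrite (adjunction_n_comp _ (@conn_csym _) csym clT (induced_adjunction _)).
apply: eq_n_comp_r => v; apply: esym; rewrite inE. exact: (valP v).
Qed.

(** The complement of [T :\ v] is [v |: ~: T], so [ccroots_lt] makes the cutset condition local. *)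
Lemma cutsetP T : cutset T <-> forall v, v \in T ->
  exists u w, [/\ u \notin T, w \notin T, sedge v u, sedge v w & ~~ conn (~: T) u w].
Proof.
have E v : v \in T -> (c_del (T :\ v) < c_del T)%N <->
    exists u w, [/\ u \notin T, w \notin T, sedge v u, sedge v w & ~~ conn (~: T) u w].
  move=> vT; rewrite !c_delE setCD setUC.
  have vN : v \notin ~: T by rewrite inE vT.
  apply: (iff_trans (ccroots_lt vN)).
  by split=> -[u [w h]]; exists u, w; move: h; rewrite !in_setC.
split=> [/forall_inP cT v vT|H]; first exact/E/cT.
by apply/forall_inP => v vT; apply/E/H.
Qed.

End Connectivity.

(** * Nonseparable sets and blocks *)

Section Nonseparable.
Variable G : sgraph.
Implicit Types (A B C D T : {set G}) (u v w x y z : G).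

Lemma conn_induced A (X : {set induced A}) (x y : induced A) :
  conn X x y = conn (val @: X) (val x) (val y).
Proof.
have clA : closed (erel (val @: X)) A.
  by apply: (intro_closed (@conn_csym _ _)) => a b /and3P[_ /imsetP[c _ ->]] _ _; apply: valP.
have adj : rel_adjunction (fun v : induced A => val v) (erel (val @: X)) (erel X) A.
  apply: (strict_adjunction (@conn_csym _ _) clA) => [||a b _].
  - exact: val_inj.
  - by apply/subsetP => z zA; apply/codomP; exists (exist _ z zA : induced A).
  by rewrite /erel /= !mem_imset //; apply: val_inj.
by rewrite /conn (rel_functor adj) // (valP x).
Qed.

Lemma connectedP : connected G <->
  (exists x : G, True) /\ (forall x y, conn [set: G] x y).
Proof.
have -> : connected G = (#|ccroots [set: G]| == 1).
  rewrite -n_comp_ccroots /connected /ncomponents.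
  rewrite (eq_n_comp_r (a' := [set: G])) => [|v]; last by rewrite !inE.
  by congr (_ == _); apply: eq_n_comp; apply: eq_connect => a b; rewrite /erel /= !inE.
split=> [/cards1P[r rE]|[[x _] cx]].
  split=> [|x y]; first by exists r.
  by apply/ccrootP; have /set1P-> : ccroot setT x \in [set r];
    rewrite -?rE ?ccroots_root ?inE //; apply/esym/set1P; rewrite -rE ccroots_root ?inE.
apply/cards1P; exists (ccroot setT x); apply/setP => r; rewrite [RHS]inE.
apply/idP/eqP => [rR|->]; last by rewrite ccroots_root ?inE.
by apply: (@ccroots_conn _ setT) => //; rewrite ccroots_root ?inE.
Qed.

Lemma cutpointP v : cutpoint v <->
  exists u w, [/\ u != v, w != v, sedge v u, sedge v w & ~~ conn (~: [set v]) u w].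
Proof.
apply: (iff_trans (cutsetP _)); split=> [/(_ v (set11 v))[u [w]]|[u [w h]] v' /set1P->].
  by rewrite !inE => h; exists u, w.
by exists u, w; rewrite !inE.
Qed.

(** The property whose maximal sets are the blocks, free of induced types ([nonsepE]). Letting [D]
    be empty or a singleton treats connectedness and absence of cutpoints together. *)
Definition nonsep A : Prop := (exists x, x \in A) /\
  forall D, #|D| <= 1 -> forall x y, x \in A :\: D -> y \in A :\: D ->
    conn (A :\: D) x y.

End Nonseparable.

Lemma no_cutpoint_conn (F : sgraph) : (forall x y : F, conn setT x y) ->
  (forall v : F, ~~ cutpoint v) <->
  (forall v x y : F, x != v -> y != v -> conn (~: [set v]) x y).
Proof.
move=> Fc; split=> [nc v x y xv yv|cF v]; last first.
  by apply/negP => /cutpointP[u [w [uv wv _ _]]]; rewrite cF.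
have E : v |: ~: [set v] = setT by apply/setP => z; rewrite !inE orbN.
apply: (@conn_setU1 _ _ v); rewrite ?E ?inE ?eqxx // => u w.
rewrite !inE => uv wv vu vw; apply/negPn/negP => nuw.
by case/negP: (nc v); apply/cutpointP; exists u, w.
Qed.

Lemma nonsepE (G : sgraph) (A : {set G}) :
  (connected (induced A) && [forall v : induced A, ~~ cutpoint v]) <-> nonsep A.
Proof.
have valT : val @: [set: induced A] = A.
  apply/setP => z; apply/imsetP/idP => [[x _ ->]|zA]; first exact: valP.
  by exists (exist _ z zA : induced A); rewrite ?inE.
have valC (v : induced A) : val @: (~: [set v]) = A :\ val v.
  apply/setP => z; rewrite !inE; apply/imsetP/andP => [[x]|[zv zA]].
    by rewrite !inE => xv ->; rewrite (inj_eq val_inj) xv (valP x).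
  exists (exist _ z zA : induced A) => //; rewrite !inE.
  by apply: contra zv => /eqP <-.
split=> [/andP[/connectedP[[x _] cA] /forallP nc]|[[x xA] cA]].
  split=> [|D]; first by exists (val x); apply: valP.
  have cE a b : a \in A -> b \in A -> conn A a b.
    move=> aA bA; have := cA (exist _ a aA : induced A) (exist _ b bA : induced A).
    by rewrite conn_induced valT.
  have [DA|] := boolP [disjoint A & D].
    by move=> _ a b; rewrite (setDidPl DA); apply: cE.
  rewrite -setI_eq0 => /set0Pn[v /setIP[vA vD]] D1.
  have -> : D = [set v].
    by apply/eqP; rewrite eq_sym eqEcard sub1set vD cards1.
  move=> a b /setDP[aA aD] /setDP[bA bD]; move: aD bD; rewrite !inE => av bv.
  have := (no_cutpoint_conn cA).1 nc (exist _ v vA : induced A)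
    (exist _ a aA : induced A) (exist _ b bA : induced A).
  by rewrite conn_induced valC; apply; rewrite -(inj_eq val_inj).
have cT : forall a b : induced A, conn setT a b.
  move=> a b; rewrite conn_induced valT; have := cA set0; rewrite setD0 cards0.
  by apply=> //; apply: valP.
apply/andP; split.
  by apply/connectedP; split=> //; exists (exist _ x xA : induced A).
apply/forallP; apply/no_cutpoint_conn => // v a b av bv; rewrite conn_induced valC.
by apply: cA; rewrite ?cards1 // !inE (inj_eq val_inj) ?av ?bv; apply: valP.
Qed.

Lemma blockP (G : sgraph) (B : {set G}) : block B <->
  nonsep B /\ forall A, nonsep A -> B \subset A -> A = B.
Proof.
split=> [/maxsetP[/nonsepE nB maxB]|[nB maxB]].
  by split=> // A /nonsepE; apply: maxB.
apply/maxsetP; split; first exact/nonsepE.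
by move=> A /nonsepE; apply: maxB.
Qed.

Lemma sorted_conn (G : sgraph) (s : seq G) : sorted (@sedge G) s ->
  {in s &, forall a b, conn [set z in s] a b}.
Proof.
move=> ss; have hd a q : path (@sedge G) a q ->
    {in a :: q, forall z, conn [set z in a :: q] a z}.
  elim: q a => [|b q IHq] a /=; first by move=> _ z; rewrite inE => /eqP->; apply: conn_refl.
  move=> /andP[ab /IHq bq] z; rewrite inE => /orP[/eqP->|/bq bz]; first exact: conn_refl.
  apply: (@conn_trans _ _ b); first by apply: conn_edge; rewrite ?inE ?eqxx ?orbT.
  by apply: conn_sub bz; apply/subsetP => t; rewrite !inE => ->; rewrite orbT.
case: s ss => [|c s] //= /hd cs a b ac bc; apply: (@conn_trans _ _ c); last exact: cs.
by rewrite conn_sym; apply: cs.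
Qed.

(** Adding an ear preserves nonseparability: whichever vertex is removed, each remaining ear vertex
    still reaches [B] along one of its two directions. *)
Lemma nonsep_ear (G : sgraph) (B : {set G}) (w w' y : G) (p : seq G) :
  nonsep B -> w \in B -> w' \in B -> w != w' -> path (@sedge G) y p ->
  uniq (y :: p) -> [disjoint B & y :: p] -> sedge w y -> sedge w' (last y p) ->
  nonsep (B :|: [set z in y :: p]).
Proof.
move=> [[b bB] cB] wB w'B ww' yp up dBp wy w'l; set C := [set z in _].
split=> [|D D1]; first by exists b; rewrite inE bB.
have key c : c \in C -> c \notin D -> exists2 b, b \in B :\: D & conn ((B :|: C) :\: D) c b.
  move=> cC cD.
  have [DC|] := boolP [disjoint C & D].
    have CS : C \subset (B :|: C) :\: D by rewrite subsetD subsetUr.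
    have cC' z : z \in y :: p -> conn ((B :|: C) :\: D) c z.
      move=> zp; apply: conn_sub CS _; apply: sorted_conn => //; by rewrite inE in cC.
    have fin g z : g \in B -> g \notin D -> z \in y :: p -> sedge g z ->
        exists2 b, b \in B :\: D & conn ((B :|: C) :\: D) c b.
      move=> gB gD zp gz; exists g; first by rewrite inE gD.
      apply: conn_trans (cC' z zp) _; rewrite conn_sym; apply: conn_edge => //.
        by rewrite !inE gD gB.
      by apply: (subsetP CS); rewrite inE.
    (* The ear is intact, and at most one of its two ends [w], [w'] is removed. *)
    have [wD|wD] := boolP (w \in D); last by apply: (fin w y); rewrite ?mem_head.
    apply: (fin w' (last y p)); rewrite ?mem_last //.
    apply: contraL D1 => w'D; rewrite -ltnNge.
    have <- : #|[set w; w']| = 2 by rewrite cards2 ww'.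
    by apply/subset_leq_card/subsetP => z; rewrite !inE => /orP[] /eqP->.
  rewrite -setI_eq0 => /set0Pn[v /setIP[vC vD]].
  have DE : D = [set v] by apply/eqP; rewrite eq_sym eqEcard sub1set vD cards1.
  have BD g : g \in B -> g \in B :\: D.
    move=> gB; rewrite inE gB andbT DE inE; apply: contraTneq vC => <-.
    by rewrite inE (disjointFr dBp).
  rewrite DE inE in cD; rewrite !inE in vC cC.
  (* The removed [v] splits the ear: the part [s1] before it is attached to [w], the part [s2] after
     it to [w']. *)
  have [s1 [s2 sE]] : exists s1 s2, y :: p = s1 ++ v :: s2.
    by move: vC; rewrite -in_cons => /splitPr[s1 s2]; exists s1, s2.
  have ss : sorted (@sedge G) (s1 ++ v :: s2) by rewrite -sE.
  have us : uniq (s1 ++ v :: s2) by rewrite -sE.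
  have fin s g z : sorted (@sedge G) s -> {subset s <= y :: p} -> v \notin s ->
      c \in s -> g \in B -> z \in s -> sedge g z ->
      exists2 b, b \in B :\: D & conn ((B :|: C) :\: D) c b.
    move=> ss' sp vs cs gB zs gz; exists g; first exact: BD.
    have sS : [set t in s] \subset (B :|: C) :\: D.
      apply/subsetP => t; rewrite inE => ts; rewrite !inE -in_cons sp // orbT andbT DE inE.
      by apply: contraNneq vs => <-.
    apply: (@conn_trans _ _ z); first by apply: conn_sub sS _; apply: sorted_conn.
    rewrite conn_sym; apply: conn_edge => //; last by apply: (subsetP sS); rewrite inE.
    by apply: (subsetP (setSD D (subsetUl B C))); apply: BD.
  move: us; rewrite cat_uniq /= => /and3P[_ /norP[vs1 _] /andP[vs2 _]].
  have [/= ss1 ss2] : sorted (@sedge G) s1 /\ sorted (@sedge G) s2.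
    by have [h1 h2] := cat_sorted2 ss; split=> //; apply: (path_sorted (x := v)).
  have : c \in s1 ++ v :: s2 by rewrite -sE inE.
  rewrite mem_cat inE (negPf cD) /= => /orP[cs|cs].
    case: s1 sE ss1 cs vs1 {ss} => // a s1 sE ss1 cs vs1.
    apply: (fin _ w y ss1) => //; last by case: sE => -> _; apply: mem_head.
    by move=> t ts; rewrite sE mem_cat ts.
  have lE : last y p = last v s2 by rewrite -(last_cons y) sE last_cat.
  apply: (fin _ w' (last y p) ss2) => //.
    by move=> t ts; rewrite sE mem_cat inE ts !orbT.
  by rewrite lE; case: (s2) cs => //= a s _; apply: mem_last.
have keyA x : x \in (B :|: C) :\: D ->
    exists2 b, b \in B :\: D & conn ((B :|: C) :\: D) x b.
  move=> /setDP[/setUP[xB|xC] xD]; last exact: key.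
  by exists x; [rewrite inE xD|apply: conn_refl].
move=> x x' /keyA[c cBD xc] /keyA[c' c'BD x'c']; apply: conn_trans xc _.
rewrite conn_sym; apply: conn_trans x'c' _; rewrite conn_sym.
by apply: conn_sub (setSD D (subsetUl B C)) _; apply: cB.
Qed.

(** * The graph [bar B] as a contraction of [G] *)

Section Gates.
Variables (G : sgraph) (B : {set G}).
Hypothesis connG : connected G.
Hypothesis unmG : forall T : {set G}, cutset T -> c_del T = #|T| + c_del (set0 : {set G}).
Hypothesis blockB : block B.

Implicit Types (T : {set G}) (u v w x y z : G).

Lemma conn_total x y : conn [set: G] x y.
Proof. by have [_] := (connectedP G).1 connG; apply. Qed.

Lemma c_del0 : c_del (set0 : {set G}) = 1.
Proof.
rewrite c_delE setC0; have [[x _] _] := (connectedP G).1 connG.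
apply/eqP/cards1P; exists (ccroot setT x); apply/setP => r; rewrite [RHS]inE.
apply/idP/eqP => [rR|->]; last by rewrite ccroots_root ?inE.
by apply: (@ccroots_conn _ setT) => //; rewrite ?ccroots_root ?inE //; apply: conn_total.
Qed.

Lemma block_nonsep : nonsep B. Proof. by have [] := (blockP B).1 blockB. Qed.

Lemma block_max A : nonsep A -> B \subset A -> A = B.
Proof. by have [_] := (blockP B).1 blockB; apply. Qed.

Lemma block_conn : {in B &, forall x y, conn B x y}.
Proof.
move=> x y xB yB; have [_ /(_ set0)] := block_nonsep; rewrite cards0 setD0.
by apply.
Qed.

(** The gates of [z] are the attachments in [B] of the component of [G \ B] that contains [z]. *)
Definition gate z w := (w \in B) && [exists y, [&& y \notin B, sedge w y & conn (~: B) y z]].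

Lemma gateP z w : reflect (w \in B /\ exists y, [/\ y \notin B, sedge w y & conn (~: B) y z])
  (gate z w).
Proof.
apply: (iffP andP) => [[wB /existsP[y /and3P[*]]]|[wB [y [yB wy yz]]]].
  by split=> //; exists y.
by split=> //; apply/existsP; exists y; rewrite yB wy.
Qed.

Lemma gate_notin z w : gate z w -> z \notin B.
Proof.
by move=> /gateP[_ [y [yB _ /conn_mem]]]; rewrite !inE; apply.
Qed.

Lemma gate_in z w : gate z w -> w \in B. Proof. by case/andP. Qed.

Lemma gate_nbr z w : z \notin B -> w \in B -> sedge w z -> gate z w.
Proof. by move=> zB wB wz; apply/gateP; split=> //; exists z; rewrite conn_refl. Qed.

Lemma gate_edge z z' w : gate z w -> z' \notin B -> sedge z z' -> gate z' w.
Proof.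
move=> /[dup] /gate_notin zB /gateP[wB [y [yB wy yz]]] z'B zz'.
apply/gateP; split=> //; exists y; split=> //; apply: conn_trans yz _.
by apply: conn_edge; rewrite ?in_setC.
Qed.

Lemma gate_ex z : z \notin B -> exists w, gate z w.
Proof.
move=> zB; have [[b bB] _] := block_nonsep.
suff : z \in [pred x | (x \in B) || [exists w, gate x w]].
  by rewrite inE (negPf zB) => /existsP.
apply: (erel_closed _ (conn_total b z)); last by rewrite inE bB.
move=> x y _ _ xy; rewrite !inE; have [//|yB] := boolP (y \in B).
have [xB _|xB /= /existsP[w xw]] := boolP (x \in B).
  by apply/existsP; exists x; apply: gate_nbr.
by apply/existsP; exists w; apply: gate_edge xw _ _.
Qed.

(** Two gates would be the ends of an ear of [B], contradicting maximality through [nonsep_ear]. *)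
Lemma gate_uniq z w w' : gate z w -> gate z w' -> w = w'.
Proof.
move=> /gateP[wB [y [yB wy yz]]] /gateP[w'B [y' [y'B w'y' y'z]]].
apply/eqP/negPn/negP => ww'.
have /connectP[p0 yp0 y'E] : conn (~: B) y y'.
  by apply: conn_trans yz _; rewrite conn_sym.
(* The ear must be a simple path outside [B]. *)
case: (shortenP yp0) y'E => p yp up _ y'E.
have pB : {subset y :: p <= ~: B}.
  move: (y) yB yp {up y'E}; elim: p => [|a p IHp] t tB /=.
    by move=> _ c; rewrite !inE => /eqP->.
  move=> /andP[/and3P[_ aB _] ap] c; rewrite inE => /orP[/eqP->|]; first by rewrite inE.
  by apply: IHp ap c; rewrite inE in aB.
have nA : nonsep (B :|: [set z in y :: p]).
  apply: (nonsep_ear block_nonsep wB w'B ww' _ up _ wy); last by rewrite -y'E.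
    by apply: sub_path yp => a b /and3P[].
  rewrite disjoint_sym; apply/pred0P => c /=; apply/negP => /andP[/pB].
  by rewrite inE => /negPf->.
have := block_max nA (subsetUl _ _) => /setP/(_ y).
by rewrite !inE eqxx orbT (negPf yB).
Qed.

Lemma gate_block_nbr z w x : gate z w -> x \in B -> sedge z x -> x = w.
Proof.
move=> zw xB zx; apply: (@gate_uniq z) => //; apply: gate_nbr => //.
  exact: gate_notin zw.
by rewrite sedge_sym.
Qed.

(** The only vertex of [B] adjacent to a vertex with gate [w] is [w], so these vertices cannot be
    left without passing through [w]. *)
Lemma gate_closed z w x : gate z w -> conn (~: [set w]) z x -> gate x w.
Proof.
move=> zw zx; have: x \in [pred t | gate t w]; last by rewrite inE.
apply: (erel_closed _ zx); last by rewrite inE.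
move=> a b _; rewrite !inE => bw ab aw.
apply: (gate_edge aw _ ab); apply: contra bw => bB.
by apply/eqP; apply: (gate_block_nbr aw bB ab).
Qed.

Lemma gate_block_other z w : gate z w -> exists2 b, b \in B & b != w.
Proof.
move=> /gateP[wB [y [yB wy _]]].
case: (pickP [pred b in B | b != w]) => [b /andP[]|none]; first by exists b.
have BE : B = [set w].
  apply/setP => b; rewrite inE; apply/idP/eqP => [bB|->//].
  by apply/eqP; move: (none b); rewrite inE bB => /negbFE.
(* If [B] were reduced to [w], the edge from [w] to [y] would be a larger nonseparable set. *)
have /block_max : nonsep [set w; y].
  split=> [|D _ a b]; first by exists w; rewrite !inE eqxx.
  move=> /[dup] aA /setDP[/set2P aE _] /[dup] bA /setDP[/set2P bE _].
  case: aE aA => ->; case: bE bA => -> bA aA; rewrite ?conn_refl //.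
    exact: conn_edge.
  by apply: conn_edge; rewrite // sedge_sym.
rewrite BE => /(_ _)/setP/(_ y); rewrite !inE eqxx orbT => /(_ _)/esym h.
by move: yB; rewrite BE inE h // sub1set !inE eqxx.
Qed.

(** A neighbour of [w] outside [B] and one inside [B] are separated by [w]; the latter exists since
    [B] is connected with a second vertex. *)
Lemma gate_cutpoint z w : gate z w -> cutpoint w.
Proof.
move=> /[dup] /gate_block_other[b bB bw] /gateP[wB [y [yB wy _]]].
have yw := gate_nbr yB wB wy.
case: (pickP [pred c in B | sedge w c]) => [c /andP[cB wc]|none].
  have cw : c != w by apply: contraTneq wc => ->; rewrite sedge_irrefl.
  apply/cutpointP; exists y, c; split=> //.
    by apply: contraNneq yB => ->.
  by apply/negP => /(gate_closed yw)/gate_notin; rewrite cB.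
have: b \in [pred c | c == w]; last by rewrite inE (negPf bw).
apply: (erel_closed _ (block_conn wB bB)); last by rewrite inE.
by move=> c d cB dB cd; rewrite !inE => /eqP cw; move: (none d); rewrite inE dB -cw cd.
Qed.

(** By unmixedness at the cutset [[set w]], deleting [w] leaves two components. One contains the
    other vertices of [B], so [z] and [z'] share the remaining one. *)
Lemma gate_conn z z' w : gate z w -> gate z' w -> conn (~: B) z z'.
Proof.
move=> zw z'w; have [b bB bw] := gate_block_other zw.
have zNw t : gate t w -> t \in ~: [set w].
  move=> /[dup] /gate_in wB /gate_notin; rewrite !inE.
  by apply: contraNneq => ->.
have bN : b \in ~: [set w] by rewrite !inE.
have zz' : conn (~: [set w]) z z'.
  apply/negPn/negP => nzz'.
  have nb t : gate t w -> ccroot (~: [set w]) t != ccroot (~: [set w]) b.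
    move=> tw; apply/negP => /eqP/ccrootP/(gate_closed tw)/gate_notin.
    by rewrite bB.
  have := unmG (gate_cutpoint zw); rewrite cards1 c_del0 c_delE.
  set R := ccroots _; set r := ccroot _ in nb => R2.
  have sR : [set r z; r z'; r b] \subset R.
    apply/subsetP => t; rewrite !in_setU !in_set1.
    by case/orP => [/orP[]|] /eqP->; apply: ccroots_root => //; apply: zNw.
  have := subset_leq_card sR; rewrite R2 setUC cardsU1 cards2 !inE.
  have -> : r z != r z' by apply: contra nzz' => /eqP/ccrootP.
  by rewrite ![r b == _]eq_sym !(negPf (nb _ _)).
(* A path from [z] to [z'] avoiding [w] keeps gate [w] throughout, hence never enters [B]. *)
suff /andP[] : z' \in [pred t | gate t w && conn (~: B) z t] by move=> /= _.
apply: (erel_closed _ zz'); last by rewrite inE zw conn_refl.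
move=> s t sw tw st; rewrite !inE => /andP[gs zs].
have gt : gate t w by apply: gate_closed gs _; apply: conn_edge.
rewrite gt; apply: conn_trans zs _; apply: conn_edge => //.
  by rewrite inE (gate_notin gs).
by rewrite inE (gate_notin gt).
Qed.

(** If [w] were the gate of no vertex, every other vertex would reach [B :\ w] through its own gate
    while avoiding [w], and [B :\ w] is connected. *)
Lemma cutpoint_gate w : w \in B -> cutpoint w -> exists z, gate z w.
Proof.
move=> wB /cutpointP[u [u' [uw u'w _ _ nuu']]].
case: (pickP [pred z | gate z w]) => [z zw|none]; first by exists z.
have toB t : t != w -> exists2 b, b \in B :\ w & conn (~: [set w]) t b.
  move=> tw; have [tB|tB] := boolP (t \in B).
    by exists t; rewrite ?inE ?tw // conn_refl.
  have [g tg] := gate_ex tB; have gw : g != w.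
    by apply: contraFneq (none t) => <-; rewrite inE.
  have /gateP[gB [y [yB gy yt]]] := tg.
  have sB : ~: B \subset ~: [set w] by rewrite setCS sub1set.
  exists g; first by rewrite !inE gw.
  rewrite conn_sym; apply: conn_trans (conn_sub sB yt).
  by apply: conn_edge; rewrite ?inE // (contraNneq _ yB) // => ->.
have [b bB ub] := toB u uw; have [b' b'B u'b'] := toB u' u'w.
case/negP: nuu'; apply: conn_trans ub _; rewrite conn_sym; apply: conn_trans u'b' _.
have sB : B :\: [set w] \subset ~: [set w].
  by apply/subsetP => t; rewrite !inE => /andP[].
by apply: (conn_sub sB); have [_] := block_nonsep; apply; rewrite ?cards1.
Qed.

Local Notation H := (bar B).

(** A section of the contraction: a leaf goes to a chosen vertex of the piece behind its cutpoint.
    The choice succeeds by [block_cutpoint_gate]. *)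
Definition lift_bar (p : H) : G :=
  match p with
  | inl x => val x
  | inr w => odflt (val w) [pick z | gate z (val w)]
  end.

(** The fibre of the contraction above [p]. By [over_ex] and [over_inj] the fibres partition [G],
    which determines [contract]. *)
Definition over (p : H) z : bool :=
  match p with inl x => z == val x | inr w => gate z (val w) end.

Lemma block_cutpoint_gate (w : {w : G | w \in block_cutpoints B}) :
  gate (lift_bar (inr w)) (val w).
Proof.
rewrite /=; case: pickP => [z //|none].
have := valP w; rewrite inE => /andP[wB wc].
by have [z zw] := cutpoint_gate wB wc; move: (none z); rewrite /= zw.
Qed.

Lemma over_lift p : over p (lift_bar p).
Proof. by case: p => [x|w]; [apply: eqxx|apply: block_cutpoint_gate]. Qed.

Lemma over_ex z : exists p, over p z.
Proof.
have [zB|/gate_ex[w zw]] := boolP (z \in B).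
  by exists (inl (exist _ z zB) : H) => /=.
have wW : w \in block_cutpoints B by rewrite inE (gate_in zw) (gate_cutpoint zw).
by exists (inr (exist _ w wW) : H).
Qed.

Lemma over_inj p q z : over p z -> over q z -> p = q.
Proof.
case: p q => [x|w] [y|t] /=.
- by move=> /eqP-> /eqP xy; congr inl; apply: val_inj.
- by move=> /eqP-> /gate_notin; rewrite (valP x).
- by move=> /[swap] /eqP-> /gate_notin; rewrite (valP y).
- by move=> zw /(gate_uniq zw)/val_inj->.
Qed.

Definition contract z : H := xchoose (over_ex z).

Lemma over_contract z : over (contract z) z. Proof. exact: (xchooseP (over_ex z)). Qed.

Lemma lift_barK : cancel lift_bar contract.
Proof. by move=> p; apply: (over_inj (over_contract _) (over_lift p)). Qed.

Definition is_leaf (p : H) : bool := if p is inr _ then true else false.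

(** * Components after deleting vertices of the block *)

Section Contraction.
Variable T : {set H}.
Hypothesis noleaf : {in T, forall p, ~~ is_leaf p}.
Let U : {set G} := lift_bar @: T.

Let in_U p : (lift_bar p \in U) = (p \in T).
Proof. by rewrite mem_imset //; apply: (can_inj lift_barK). Qed.

Let U_sub : ~: B \subset ~: U.
Proof.
rewrite setCS; apply/subsetP => _ /imsetP[p pT ->].
by case: p pT => [x _|w /noleaf//]; apply: valP.
Qed.

Let over_notin p z : over p z -> z \notin U -> p \notin T.
Proof.
case: p => [x /= /eqP->|w _ _]; first by rewrite -(in_U (inl x)).
by apply/negP => /noleaf.
Qed.

(** As [T] has no leaf, [U] lies in [B] and all pieces outside [B] survive. Then [contract] and
    [lift_bar] both preserve connectivity, and going to [bar B] and back stays in the same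
    component. *)
Lemma contraction_adjunction : rel_adjunction lift_bar (erel (~: U)) (erel (~: T)) (~: U).
Proof.
have csG := @conn_csym G (~: U); have csH := @conn_csym H (~: T).
have cl : closed (erel (~: U)) (~: U) by apply: (intro_closed csG) => x y /and3P[].
apply: (intro_adjunction csH cl (fun z _ => contract z)).
  move=> z zU; split=> [|t tU].
    move: (over_contract z); rewrite -/(conn _ _ _).
    case: (contract z) => [x /= /eqP->|w zw]; first exact: conn_refl.
    apply: (conn_sub U_sub); apply: gate_conn zw _; exact: block_cutpoint_gate.
  move=> /and3P[_ _ zt]; rewrite -/(conn _ _ _).
  have [oz ot] := (over_contract z, over_contract t).
  rewrite !inE in zU tU.
  have [zT tT] := (over_notin oz zU, over_notin ot tU).
  move: (contract z) (contract t) oz ot zT tT => p q oz ot pT qT.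
  (* An edge of [G] stays an edge inside [B], becomes a leaf edge when it leaves [B] through a gate,
     and collapses to one leaf when it lies outside [B]. *)
  case: p q oz ot pT qT => [x|w] [y|v] /= oz ot pT qT.
  - apply: conn_edge; rewrite ?inE //=.
    by rewrite /induced_edge /= -(eqP oz) -(eqP ot).
  - apply: conn_edge; rewrite ?inE //=; rewrite -(eqP oz).
    apply/eqP; apply: (gate_block_nbr ot); first by rewrite (eqP oz) (valP x).
    by rewrite sedge_sym.
  - apply: conn_edge; rewrite ?inE //=; rewrite -(eqP ot).
    by apply/eqP; apply: (gate_block_nbr oz); rewrite // (eqP ot) (valP y).
  - have -> : w = v; last exact: conn_refl.
    apply/val_inj; apply: (gate_uniq (z := t)) => //.
    by apply: (gate_edge oz) => //; apply: gate_notin ot.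
move=> p pU; split=> [|q]; first by rewrite lift_barK; apply: connect0.
move=> /and3P[]; rewrite !in_setC -(in_U p) -(in_U q) -!in_setC => {}pU qU pq.
rewrite -/(conn _ _ _).
(* A leaf edge lifts to an edge leaving [B] at the cutpoint, followed by a path in the piece behind
   it. *)
have leaf (x : induced B) (w : {w : G | w \in block_cutpoints B}) :
    val x = val w -> lift_bar (inl x) \in ~: U ->
    conn (~: U) (lift_bar (inl x)) (lift_bar (inr w)).
  move=> xw xU; have /gateP[wB [y [yB wy yz]]] := block_cutpoint_gate w.
  apply: conn_trans (conn_sub U_sub yz); apply: conn_edge => //.
    by apply: (subsetP U_sub); rewrite inE.
  by rewrite /= xw.
case: p q pU qU pq => [x|w] [y|v] // pU qU.
- by move=> xy; apply: conn_edge.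
- by move=> /eqP xv; apply: leaf.
- by move=> /eqP yw; rewrite conn_sym; apply: leaf.
Qed.

Lemma c_del_lift : c_del (lift_bar @: T) = c_del T.
Proof.
have cl : closed (erel (~: U)) (~: U).
  by apply: (intro_closed (@conn_csym _ _)) => x y /and3P[].
rewrite !c_delE -!n_comp_ccroots.
rewrite (adjunction_n_comp _ (@conn_csym _ _) (@conn_csym _ _) cl contraction_adjunction).
by apply: eq_n_comp_r => p; rewrite !inE in_U.
Qed.

End Contraction.

Lemma lift_barD1 (T : {set H}) p : (lift_bar @: T) :\ lift_bar p = lift_bar @: (T :\ p).
Proof.
have inj := can_inj lift_barK; apply/setP => z; apply/setD1P/imsetP.
  move=> [zp /imsetP[q qT zq]]; exists q => //; rewrite !inE qT andbT.
  by apply: contraNneq zp => <-; rewrite zq.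
by move=> [q /setD1P[qp qT] ->]; rewrite (inj_eq inj) imset_f.
Qed.

(** A leaf has a single neighbour, so it cannot have two neighbours in different components. *)
Lemma cutset_noleaf (T : {set H}) : cutset T -> {in T, forall p, ~~ is_leaf p}.
Proof.
move=> /cutsetP cT [//|w] /cT[[x|v] [[y|t] [_ _ // /eqP xw /eqP yw]]].
by rewrite (val_inj (etrans xw (esym yw))) conn_refl.
Qed.

Lemma cutset_lift (T : {set H}) : {in T, forall p, ~~ is_leaf p} ->
  cutset (lift_bar @: T) = cutset T.
Proof.
move=> noleaf; have noleafD p : {in T :\ p, forall p, ~~ is_leaf p}.
  by move=> q /setD1P[_ /noleaf].
apply/forall_inP/forall_inP => cT p.
  by move=> pT; have := cT _ (imset_f lift_bar pT); rewrite lift_barD1 !c_del_lift.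
by move=> /imsetP[q qT ->]; rewrite lift_barD1 !c_del_lift //; apply: cT.
Qed.

Lemma bar_cutset_card (T : {set H}) :
  cutset T -> c_del T = #|T| + c_del (set0 : {set H}).
Proof.
move=> cT; have nlT := cutset_noleaf cT.
rewrite -(c_del_lift nlT) unmG ?cutset_lift // card_imset; last exact: can_inj lift_barK.
congr (_ + _); rewrite -[RHS]c_del_lift ?imset0 // => p; by rewrite inE.
Qed.

Lemma bar_cutset_accessible :
  (forall T : {set G}, cutset T -> T != set0 -> exists2 t, t \in T & cutset (T :\ t)) ->
  forall T : {set H}, cutset T -> T != set0 -> exists2 t, t \in T & cutset (T :\ t).
Proof.
move=> accG T cT T0; have nlT := cutset_noleaf cT.
have [||_ /imsetP[t tT ->]] := accG (lift_bar @: T); rewrite ?cutset_lift //.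
  by rewrite imset_eq0.
rewrite lift_barD1 cutset_lift; first by exists t.
by move=> q /setD1P[_ /nlT].
Qed.

End Gates.

From mathcomp Require Import boolp classical_sets.
From mathcomp Require Import generic_quotient ring_quotient fraction.
From mathcomp Require Import mpoly zify ring.
Import GRing.Theory.
Local Open Scope ring_scope.

(** * Prime ideals as kernels *)

Section PrimeQuotient.
Variables (R : comNzRingType) (P : set R) (primeP : prime_ideal P).

(** The proof is an argument so that the ideal structures can be attached to [prime_pred primeP]. *)
Definition prime_pred (_ : prime_ideal P) : R -> bool := fun x => x \in P.
Local Notation Pb := (prime_pred primeP).

HB.instance Definition _ := isIdealr.Build R Pb primeP.1.
HB.instance Definition _ := isPrimeIdealrClosed.Build R Pb primeP.2.

Definition prime_ideal_pred : prime_idealr R := Pb.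

Definition prime_quot : Type := {ideal_quot prime_ideal_pred}.
HB.instance Definition _ := GRing.ComNzRing.on prime_quot.

(** Inverses are chosen classically, which makes the quotient an [idomainType] with a fraction
    field. *)
Definition prime_quot_unit : pred prime_quot := fun x => `[< exists y, y * x = 1 >].
Definition prime_quot_inv (x : prime_quot) : prime_quot :=
  if pselect (exists y, y * x = 1) is left e then projT1 (cid e) else x.

Lemma prime_quot_mulVx : {in prime_quot_unit, left_inverse 1 prime_quot_inv *%R}.
Proof.
move=> x /asboolP xu; rewrite /prime_quot_inv.
by case: pselect => // e; case: cid.
Qed.

Lemma prime_quot_unitPl x y : y * x = 1 -> prime_quot_unit x.
Proof. by move=> yx; apply/asboolP; exists y. Qed.

Lemma prime_quot_inv_out : {in [predC prime_quot_unit], prime_quot_inv =1 id}.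
Proof.
move=> x /negP xu; rewrite /prime_quot_inv; case: pselect => // e.
by case: xu; apply/asboolP.
Qed.

HB.instance Definition _ := GRing.ComNzRing_hasMulInverse.Build prime_quot
  prime_quot_mulVx prime_quot_unitPl prime_quot_inv_out.

Lemma prime_quot_integral : GRing.integral_domain_axiom prime_quot.
Proof. by move=> x y; apply: (@Quotient.rquot_IdomainAxiom R prime_ideal_pred). Qed.

HB.instance Definition _ :=
  GRing.ComUnitRing_isIntegral.Build prime_quot prime_quot_integral.
End PrimeQuotient.

(** Map to the quotient and then to its fraction field. Membership in a prime becomes vanishing in a
    field. *)
Lemma prime_ideal_ker (R : comNzRingType) (P : set R) : prime_ideal P ->
  exists (L : fieldType) (f : {rmorphism R -> L}), forall a, P a <-> f a = 0.
Proof.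
move=> primeP; pose Q := prime_quot primeP.
pose pi : {rmorphism R -> Q} := \pi_({ideal_quot (prime_ideal_pred primeP)})%qT.
exists {fraction Q}, (@tofrac Q \o pi) => a.
have -> : P a <-> pi a = 0.
  have := Quotient.idealrBE (prime_ideal_pred primeP) a 0; rewrite subr0 => e.
  split=> [Pa|pa].
    have: a \in prime_pred primeP by rewrite unfold_in; apply/mem_set.
    by rewrite e => /eqP h; rewrite /pi /= h; apply: rmorph0.
  apply/set_mem; rewrite -[_ \in _]/(a \in prime_pred primeP) e; apply/eqP.
  by rewrite -[LHS]/(pi a) pa; apply/esym/(rmorph0 pi).
split=> [/= ->|/eqP]; first by rewrite rmorph0.
by rewrite /= tofrac_eq0 => /eqP.
Qed.

(** * Chains of primes in a polynomial ring *)

Section ChainBound.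
Variables (K : fieldType) (N : nat).
Local Notation S := {mpoly K[N]}.
Implicit Types (P Q : set S).

(** Linear independence over [K] of the images of [b] in the quotient by [P]. *)
Definition free_mod P (I : finType) (b : I -> S) : Prop :=
  forall a : I -> K, P (\sum_i a i *: b i) -> forall i, a i = 0.

(* Modulo [Q] only the constant coefficient in [g] of a relation survives, so it
   vanishes; then divide the relation by [g]. *)
Lemma free_mod_powers P Q (I : finType) (b : I -> S) g k :
  prime_ideal P -> prime_ideal Q -> (P `<=` Q)%classic -> Q g -> ~ P g ->
  free_mod Q b ->
  free_mod P (fun ij : 'I_k * I => g ^+ ij.1 * b ij.2).
Proof.
move=> /prime_ideal_ker[L [f Pf]] /prime_ideal_ker[L' [f' Qf]] sPQ Qg nPg fb.
(* Coefficients are indexed by [nat] so that the induction on [k] can shift them. *)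
have main (a : nat -> I -> K) : P (\sum_(i < k) g ^+ i * (\sum_j a i j *: b j)) ->
    forall i j, (i < k)%N -> a i j = 0.
  elim: k a => [|k IHk] a // Pa.
  have a0 j : a 0%N j = 0.
    apply: fb; apply/Qf; move/sPQ/Qf: Pa; rewrite big_ord_recl expr0 mul1r rmorphD.
    rewrite [X in _ + X]rmorph_sum [X in _ + X]big1 ?addr0 // => i _.
    by rewrite rmorphM rmorphXn /= (Qf g).1 // exprS !mul0r.
  have aS i j : (i < k)%N -> a i.+1 j = 0.
    apply: (IHk (fun i => a i.+1)); move: Pa.
    rewrite big_ord_recl big1 ?mulr0 ?add0r => [|j' _]; last by rewrite a0 scale0r.
    under eq_bigr do rewrite lift0 exprS -mulrA.
    rewrite -mulr_sumr => /Pf/eqP; rewrite rmorphM mulf_eq0 => /orP[/eqP/Pf//|].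
    by move=> /eqP/Pf.
  by case=> [|i] j // ik; apply: aS.
move=> a Pa [i j]; pose a' n j := if insub n is Some i then a (i, j) else 0.
have a'E (i' : 'I_k) j' : a' i' j' = a (i', j') by rewrite /a' valK.
rewrite -a'E; apply: main => //.
rewrite (eq_bigr (fun i : 'I_k => \sum_j a (i, j) *: (g ^+ i * b j))).
  by rewrite pair_big /=; under eq_bigr do rewrite -surjective_pairing.
move=> i' _; rewrite mulr_sumr; apply: eq_bigr => j' _.
by rewrite a'E scalerAr.
Qed.

(** Only monomials with all exponents below [D] occur, and there are [D ^ N] of them. Independence
    modulo [P] forces independent rows in the coefficient matrix. *)
Lemma free_mod_card P (I : finType) (b : I -> S) D : prime_ideal P ->
  free_mod P b -> (forall i, msize (b i) <= D)%N -> (#|I| <= D ^ N)%N.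
Proof.
move=> /prime_ideal_ker[L [f Pf]] fb bD; pose J := {ffun 'I_N -> 'I_D}.
pose mon (j : J) : 'X_{1..N} := [multinom (j i : nat) | i < N].
pose A := \matrix_(i < #|I|, j < #|J|) (b (enum_val i))@_(mon (enum_val j)).
have <- : #|J| = (D ^ N)%N by rewrite card_ffun !card_ord.
suff /eqP <- : row_free A by apply: rank_leq_col.
apply: inj_row_free => v vA.
have sum0 : \sum_i v 0 (enum_rank i) *: b i = 0.
  apply/mpolyP => m; rewrite mcoeff0 raddf_sum /=.
  have [mD|mD] := ltnP (mdeg m) D; last first.
    apply: big1 => i _; rewrite mcoeffZ; apply/eqP; rewrite mulf_eq0.
    by rewrite (memN_msupp_eq0 (msize_mdeg_ge (leq_trans (bD i) mD))) eqxx orbT.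
  have miD i : (m i < D)%N.
    by apply: leq_ltn_trans mD; rewrite mdegE (bigD1 i) //= leq_addr.
  pose j : J := [ffun i => Ordinal (miD i)].
  have jm : mon j = m by apply/mnmP => i; rewrite mnmE ffunE.
  have /rowP/(_ (enum_rank j)) := vA; rewrite !mxE => vAj.
  rewrite -[RHS]vAj (reindex _ (onW_bij _ (@enum_val_bij I))) /=.
  by apply: eq_bigr => i _; rewrite mcoeffZ mxE enum_rankK jm enum_valK.
apply/rowP => i; rewrite mxE -[i]enum_valK.
by apply: (fb (fun i => v 0 (enum_rank i))); rewrite sum0; apply/Pf; rewrite rmorph0.
Qed.

Lemma msizeM_leq (p q : S) : (msize (p * q) <= (msize p + msize q).-1)%N.
Proof.
have [->|p0] := eqVneq p 0; first by rewrite mul0r msize0.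
have [->|q0] := eqVneq q 0; first by rewrite mulr0 msize0.
by rewrite msizeM.
Qed.

Lemma msizeX_leq (g : S) i : (msize (g ^+ i) <= (i * msize g).+1)%N.
Proof.
elim: i => [|i IHi]; first by rewrite expr0 msize1.
rewrite exprS mulSn; apply: leq_trans (msizeM_leq _ _) _; lia.
Qed.

(** Peel off the lowest prime: for [g] in [c 1] but not in [c 0], the products of the powers
    [g ^+ i], [i < k], with a family free modulo [c 1] are free modulo [c 0]. Sizes stay linear in
    [k], with [D] independent of [k]. *)
Lemma prime_chain_free (h : nat) (c : nat -> set S) :
  (forall i, (i <= h)%N -> prime_ideal (c i)) ->
  (forall i, (i < h)%N -> (c i `<` c i.+1)%classic) ->
  exists D, forall k, exists (I : finType) (b : I -> S),
    [/\ #|I| = (k ^ h)%N, free_mod (c 0%N) b &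
        forall i, (msize (b i) <= (D * k).+1)%N].
Proof.
elim: h c => [|h IHh] c cp cs.
  exists 0%N => k; exists unit, (fun=> 1); split; rewrite ?card_unit //.
    have [_ c1 cD] := (cp 0%N isT).1.
    move=> a; rewrite (bigD1 tt) //= big1 => [|[]//]; rewrite addr0 => ca [].
    apply/eqP; apply: contraNT c1 => a0; have := cD (a tt)^-1%:MP _ 0 (mem_set ca).
    rewrite addr0 mul_mpolyC scalerA mulVf // scale1r; apply.
    by have [] := (cp 0%N isT).1.
  by move=> i; rewrite msize1.
have [D HD] := IHh (fun i => c i.+1) (fun i ih => cp i.+1 ih) (fun i ih => cs i.+1 ih).
have [s01 [g c1g c0g]] : (c 0 `<=` c 1)%classic /\ exists2 g, c 1%N g & ~ c 0%N g.
  have [s01 n10] := cs 0%N isT; split=> //; apply: contrapT => nex; apply: n10.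
  by move=> g cg; apply: contrapT => ng; apply: nex; exists g.
exists (msize g + D)%N => k; have [I [b [cI fb sb]]] := HD k.
exists ('I_k * I)%type, (fun ij : 'I_k * I => g ^+ ij.1 * b ij.2); split.
- by rewrite card_prod card_ord cI expnS.
- exact: (free_mod_powers (cp _ _) (cp _ _) s01).
move=> [i j] /=.
apply: leq_trans (msizeM_leq _ _) _; have := sb j; have := msizeX_leq g i.
by have := ltn_ord i; nia.
Qed.

(* A chain of length [h] gives [k ^ h] independent polynomials of degree [O(k)],
   which span at most [O(k) ^ N] dimensions. *)
Lemma prime_chain_leq (P : set S) h : prime_chain P h -> (h <= N)%N.
Proof.
move=> [c [_ cp cs]]; have [D HD] := prime_chain_free cp cs.
(* With [k] larger than [D.+1 ^ N], the power [k ^ N.+1] exceeds [(D.+1 * k) ^ N], which bounds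
   [(D * k).+1 ^ N]. *)
rewrite leqNgt; apply/negP => Nh; pose k := ((D.+1) ^ N).+1.
have [I [b [cI fb sb]]] := HD k.
have := free_mod_card (cp 0%N isT) fb sb; rewrite cI leqNgt => /negP[].
have kh : (k ^ N.+1 <= k ^ h)%N by rewrite leq_pexp2l.
apply: leq_trans kh.
have wexp x y e : (x <= y -> x ^ e <= y ^ e)%N.
  by move=> xy; case: e => // e; rewrite leq_exp2r.
have : ((D * k).+1 ^ N <= (D.+1 * k) ^ N)%N by apply: wexp; rewrite mulSn /k; lia.
move=> /leq_ltn_trans; apply; rewrite expnMn expnS ltn_pmul2r ?expn_gt0 //.
Qed.
End ChainBound.

Section PrimeChains.
Variable R : comNzRingType.
Implicit Types (P Q : set R) (L : idomainType).

Definition ker (L : nzRingType) (f : R -> L) : set R := fun a => f a = 0.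

Lemma ker_prime L (f : {rmorphism R -> L}) : prime_ideal (ker f).
Proof.
split=> [|a b].
  split=> [||a b c]; first by apply/mem_set; rewrite /ker rmorph0.
    by apply/negP => /set_mem; rewrite /ker rmorph1 => /eqP; rewrite oner_eq0.
  move=> /set_mem fb /set_mem fc; apply/mem_set.
  by rewrite /ker rmorphD rmorphM fb fc mulr0 addr0.
move=> /set_mem/eqP; rewrite rmorphM mulf_eq0.
by case/orP => /eqP f0; apply/orP; [left|right]; apply/mem_set.
Qed.

(** Unlike in [prime_chain], the lower end is recorded too, so that chains can be concatenated. *)
Definition chain_from_to P Q h : Prop :=
  exists c : nat -> set R, [/\ c 0%N = P, c h = Q,
    forall i, (i <= h)%N -> prime_ideal (c i) &
    forall i, (i < h)%N -> (c i `<` c i.+1)%classic].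

Lemma chain_refl P : prime_ideal P -> chain_from_to P P 0.
Proof. by move=> pP; exists (fun=> P). Qed.

Lemma chain_rcons P Q Q' h : prime_ideal Q' -> (Q `<` Q')%classic ->
  chain_from_to P Q h -> chain_from_to P Q' h.+1.
Proof.
move=> pQ' QQ' [c [c0 ch cp cs]].
exists (fun i => if (i <= h)%N then c i else Q'); split=> //.
- by rewrite ltnn.
- by move=> i _; case: ifP => // /cp.
move=> i; rewrite ltnS => ih; rewrite ih; have [/cs //|hi] := ltnP i h.
by have -> : i = h; [apply/eqP; rewrite eqn_leq ih|rewrite ch].
Qed.

Lemma chain_cat P Q P' h k : chain_from_to P Q h -> chain_from_to Q P' k ->
  chain_from_to P P' (h + k).
Proof.
move=> PQ [c [c0 <- cp cs]]; rewrite -c0 in PQ.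
elim: k cp cs => [|k IHk] cp cs; first by rewrite addn0.
rewrite addnS; apply: chain_rcons (cs k _) _ => //; first exact: cp.
by apply: IHk => i ik; [apply: cp; apply: leqW|apply: cs; apply: leqW].
Qed.

(** Enlarging the index set one element at a time turns a strictly increasing family into a
    chain. *)
Lemma chain_sets (I : finType) (D : {set I}) (F : {set I} -> set R) :
  (forall A, prime_ideal (F A)) ->
  (forall (A : {set I}) a, A \subset D -> a \in D -> a \notin A -> (F A `<` F (a |: A))%classic) ->
  chain_from_to (F finset.set0) (F D) #|D|.
Proof.
move=> Fp FD; have main n (A : {set I}) : #|A| = n -> A \subset D ->
    chain_from_to (F finset.set0) (F A) n.
  elim: n A => [|n IHn] A cA AD.
    by rewrite (cards0_eq cA); apply: chain_refl.
  have [a aA] : exists a, a \in A by apply/card_gt0P; rewrite cA.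
  rewrite -[A](finset.setD1K aA); apply: (@chain_rcons _ (F (A :\ a)%SET)) => //.
    apply: FD; rewrite ?setD11 ?(fintype.subsetP AD) //.
    exact: fintype.subset_trans (subD1set _ _) AD.
  apply: IHn; last exact: fintype.subset_trans (subD1set _ _) AD.
  by apply/eqP; rewrite -eqSS -cA (cardsD1 a A) aA.
exact: main.
Qed.

End PrimeChains.

(** A longer chain up to [P], continued to [P1], would have more than [N] steps. *)
Lemma has_height_chains (K : fieldType) (N : nat) (P0 P P1 : set {mpoly K[N]}) h k :
  chain_from_to P0 P h -> chain_from_to P P1 k -> (h + k = N)%N -> has_height P h.
Proof.
move=> c1 c2 hk; split; first by case: c1 => c [_ ch cp cs]; exists c.
move=> m [c [cm cp cs]]; have cP : chain_from_to (c 0%N) P m by exists c.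
have [c' [_ e c'p c's]] := chain_cat cP c2.
have: prime_chain P1 (m + k) by exists c'.
by move=> /prime_chain_leq; lia.
Qed.

Lemma mpoly_hom_ext (R : comNzRingType) (n : nat) (L : comNzRingType)
    (f g : {rmorphism {mpoly R[n]} -> L}) :
  (forall c, f c%:MP = g c%:MP) -> (forall i, f 'X_i = g 'X_i) -> f =1 g.
Proof.
move=> fgC fgX p; rewrite [p]mpolyE !rmorph_sum; apply: eq_bigr => m _.
rewrite -mul_mpolyC !rmorphM fgC mpolyXE_id !rmorph_prod; congr (_ * _).
by apply: eq_bigr => i _; rewrite !rmorphXn /= fgX.
Qed.

(** * Parametrized primes and their heights *)

Section Parametrization.
Variables (K : fieldType) (V : finType).
Local Notation S := {mpoly K[#|V| + #|V|]}.
Local Notation x := (fun v : V => 'X_(lshift #|V| (enum_rank v)) : S).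
Local Notation y := (fun v : V => 'X_(rshift #|V| (enum_rank v)) : S).

Lemma xy_hom_ext (L : comNzRingType) (f g : {rmorphism S -> L}) :
  (forall c, f c%:MP = g c%:MP) -> (forall v, f (x v) = g (x v)) ->
  (forall v, f (y v) = g (y v)) -> f =1 g.
Proof.
move=> fgC fgx fgy; apply: mpoly_hom_ext => // i.
by case: (split_ordP i) => j ->; rewrite -(enum_valK j).
Qed.

Definition xy_val (L : Type) (a b : V -> L) (i : 'I_(#|V| + #|V|)) : L :=
  match fintype.split i with
  | inl j => a (enum_val j)
  | inr j => b (enum_val j)
  end.

Definition xy_hom (L : comNzRingType) (f : {rmorphism K -> L}) (a b : V -> L) :
  {rmorphism S -> L} := mmap f (xy_val a b).

Lemma xy_homC L f a b c : @xy_hom L f a b c%:MP = f c.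
Proof. exact: mmapC. Qed.

Lemma xy_homx L f a b v : @xy_hom L f a b (x v) = a v.
Proof.
rewrite /xy_hom /= mmapX mmap1U /xy_val.
by rewrite -[lshift _ _]/(unsplit (inl _)) unsplitK enum_rankK.
Qed.

Lemma xy_homy L f a b v : @xy_hom L f a b (y v) = b v.
Proof.
rewrite /xy_hom /= mmapX mmap1U /xy_val.
by rewrite -[rshift _ _]/(unsplit (inr _)) unsplitK enum_rankK.
Qed.

(* The indices 0, 1, 2 stand for the variables u, s, r. *)
Definition tvar : finType := ('I_3 * V)%type.
Local Notation T := {mpoly K[#|tvar|]}.
Definition tX (i : 'I_3) (v : V) : T := 'X_(enum_rank ((i, v) : tvar)).
Local Notation Xu := (tX 0).
Local Notation Xs := (tX 1).
Local Notation Xr := (tX (lift ord0 (lift ord0 ord0))).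

Definition t_hom (L : comNzRingType) (f : {rmorphism K -> L}) (a : tvar -> L) :
  {rmorphism T -> L} := mmap f (fun i => a (enum_val i)).

Lemma t_homC L f a c : @t_hom L f a c%:MP = f c.
Proof. exact: mmapC. Qed.

Lemma t_homX L f a i v : @t_hom L f a (tX i v) = a (i, v).
Proof. by rewrite /t_hom /= mmapX mmap1U enum_rankK. Qed.

(* Otherwise [/=] unfolds the underlying [mmap]. *)
#[local] Opaque xy_hom t_hom.

(** All primes in the chains below are kernels of such maps, for various specializations of [u], [s]
    and [r]. *)
Definition param (u s r : V -> T) : {rmorphism S -> T} :=
  xy_hom (@mpolyC #|tvar| K) (fun v => u v * s v) (fun v => u v * r v).

#[local] Opaque param.

Lemma tX_neq0 i v : tX i v != 0.
Proof.
apply/eqP => /(congr1 (mcoeff U_(enum_rank ((i, v) : tvar)))) /eqP.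
by rewrite mcoeff0 mcoeffXU eqxx oner_eq0.
Qed.

Lemma tX_minor_neq0 v w : v != w -> Xs v * Xr w - Xs w * Xr v != 0.
Proof.
(* At this point only [s_v] and [r_w] are nonzero, and the minor evaluates to 1. *)
move=> vw; apply/eqP; pose a (k : tvar) : K := if k == (1, v) then 1 else
  if k == (lift ord0 (lift ord0 ord0), w) then 1 else 0.
move/(congr1 (t_hom idfun a)); rewrite rmorphB !rmorphM !t_homX rmorph0.
rewrite /a !xpair_eqE !eqxx [w == v]eq_sym (negPf vw) /= mulr1 mul0r subr0.
by move/eqP; rewrite oner_eq0.
Qed.

(** The hypotheses say that [eta] factors through the parametrization via [theta]. *)
Lemma param_ker_sub (L : idomainType) (u s r : V -> T) (eta : {rmorphism S -> L})
    (theta : {rmorphism T -> L}) :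
  (forall c, theta c%:MP = eta c%:MP) ->
  (forall v, theta (u v * s v) = eta (x v)) ->
  (forall v, theta (u v * r v) = eta (y v)) ->
  (ker (param u s r) `<=` ker eta)%classic.
Proof.
move=> tC tx ty f; rewrite /ker => f0.
have /(_ f) /= <- : (theta \o param u s r) =1 eta; last by rewrite f0 rmorph0.
apply: xy_hom_ext => [c|v|v] /=; first by rewrite xy_homC tC.
  by rewrite xy_homx tx.
by rewrite xy_homy ty.
Qed.

(** The specialization [psi] gives the inclusion, and [f] witnesses that it is strict. *)
Lemma param_ker_lt (u s r u' s' r' : V -> T) (a : tvar -> T) (f : S) :
  let psi := t_hom (@mpolyC #|tvar| K) a in
  (forall v, psi (u v * s v) = u' v * s' v) ->
  (forall v, psi (u v * r v) = u' v * r' v) ->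
  param u s r f != 0 -> param u' s' r' f = 0 ->
  (ker (param u s r) `<` ker (param u' s' r'))%classic.
Proof.
move=> psi ps pr f0 f'0; split; last by move=> /(_ f f'0) /eqP; apply/negP.
apply: (@param_ker_sub _ _ _ _ _ psi) => [c|v|v].
- by rewrite t_homC xy_homC.
- by rewrite xy_homx ps.
- by rewrite xy_homy pr.
Qed.

Lemma param_ker_eq (u s r u' s' r' : V -> T) :
  (forall v, u v * s v = u' v * s' v) -> (forall v, u v * r v = u' v * r' v) ->
  ker (param u s r) = ker (param u' s' r').
Proof.
move=> es er; apply/seteqP; split.
  by apply: (@param_ker_sub _ _ _ _ _ idfun) => [c|v|v] /=;
    rewrite ?xy_homC ?xy_homx ?xy_homy.
by apply: (@param_ker_sub _ _ _ _ _ idfun) => [c|v|v] /=;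
  rewrite ?xy_homC ?xy_homx ?xy_homy.
Qed.

Definition tsubst (j : tvar) (w : T) (k : tvar) : T := if k == j then w else tX k.1 k.2.

Variables (D : {set V}) (rho : V -> V).
Hypothesis rhoP : forall v, v \notin D -> rho v \notin D.
Hypothesis rhoK : forall v, v \notin D -> rho (rho v) = rho v.

Definition ucut (A : {set V}) v : T := if v \in A then 0 else Xu v.

(** In the application [D] is the deleted set and [rho] sends a vertex to the root of its component,
    so [s] and [r] become variables of the component. *)
Definition component_prime := ker (param (ucut D) (Xs \o rho) (Xr \o rho)).

Let reps := [set v in ~: D | rho v == v].

(** Specialize one variable or vertex at a time: [s] vanishes on [D], then [u] vanishes on [D], then
    each vertex outside [D] that is not a representative takes the [s] and [r] of its
    representative. *)
Lemma chain_below : chain_from_to (ker (param Xu Xs Xr)) component_prime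
  (#|D| + #|D| + #|~: D :\: reps|).
Proof.
apply: chain_cat; first apply: chain_cat.
- pose F (A : {set V}) := ker (param Xu (fun v => if v \in A then 0 else Xs v) Xr).
  have -> : ker (param Xu Xs Xr) = F finset.set0.
    by apply: param_ker_eq => v //; rewrite inE.
  apply: chain_sets => [A|A a AD aD aA]; first exact: ker_prime.
  apply: (@param_ker_lt _ _ _ _ _ _ (tsubst (1, a) 0) (x a)) => [v|v||].
  + rewrite rmorphM t_homX /tsubst /= in_setU1; case: (v \in A).
      by rewrite rmorph0 orbT.
    by rewrite t_homX xpair_eqE /= orbF; case: eqP.
  + by rewrite rmorphM !t_homX.
  + by rewrite xy_homx (negPf aA) mulf_neq0 ?tX_neq0.
  + by rewrite xy_homx setU11 mulr0.
- pose F (A : {set V}) := ker (param (ucut A) (fun v => if v \in D then 0 else Xs v) Xr).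
  have <- : F finset.set0 = ker (param Xu (fun v => if v \in D then 0 else Xs v) Xr).
    by apply: param_ker_eq => v //; rewrite /ucut inE.
  apply: (@chain_sets _ _ D F) => [A|A a AD aD aA]; first exact: ker_prime.
  apply: (@param_ker_lt _ _ _ _ _ _ (tsubst (0, a) 0) (y a)) => [v|v||].
  + rewrite rmorphM /ucut in_setU1; case: (v \in A).
      by rewrite orbT rmorph0 !mul0r.
    rewrite orbF t_homX /tsubst xpair_eqE /=; case: eqP => _.
      by rewrite !mul0r.
    by case: (v \in D); rewrite ?rmorph0 // t_homX.
  + rewrite rmorphM /ucut in_setU1 t_homX; case: (v \in A).
      by rewrite orbT rmorph0 !mul0r.
    by rewrite orbF t_homX /tsubst xpair_eqE /=; case: eqP.
  + by rewrite xy_homy /ucut (negPf aA) mulf_neq0 ?tX_neq0.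
  + by rewrite xy_homy /ucut setU11 mul0r.
pose F (A : {set V}) := ker (param (ucut D) (fun v => if v \in A then Xs (rho v) else Xs v)
  (fun v => if v \in A then Xr (rho v) else Xr v)).
have -> : ker (param (ucut D) (fun v => if v \in D then 0 else Xs v) Xr) =
    F finset.set0.
  apply: param_ker_eq => v; rewrite /ucut inE //.
  by case: ifP => //; rewrite !mul0r.
have -> : component_prime = F (~: D :\: reps).
  apply: param_ker_eq => v; rewrite /ucut !inE /=; case: (v \in D) => //=.
  - by rewrite !mul0r.
  - by case: eqP => // ->.
  - by rewrite !mul0r.
  - by case: eqP => // ->.
apply: (@chain_sets _ _ _ F) => [A|A a AD aD aA]; first exact: ker_prime.
have aND : a \notin D by move: aD; rewrite !inE; case: (a \in D).
have ra : rho a != a by move: aD => /finset.setDP[_]; rewrite !inE aND.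
have NA v : v \notin D -> rho v \notin A.
  move=> vD; apply/negP => /(fintype.subsetP AD).
  by rewrite !inE rhoK // rhoP // eqxx.
have rNa v : v \notin D -> rho v != a.
  by move=> vD; apply: contra ra => /eqP <-; rewrite rhoK.
(* Replace [s_a] and [r_a] by those of [rho a], keeping [u_a]. The minor of [a] and [rho a] then
   becomes zero. *)
pose tab (k : tvar) : T := if k.2 == a then
  (if k.1 == 0 then Xu a else tX k.1 (rho a)) else tX k.1 k.2.
apply: (@param_ker_lt _ _ _ _ _ _ tab (x a * y (rho a) - x (rho a) * y a)).
- move=> v; rewrite rmorphM /ucut in_setU1; case: (boolP (v \in D)) => vD.
    by rewrite rmorph0 !mul0r.
  rewrite t_homX {1}/tab /= (_ : (if v == a then Xu a else Xu v) = Xu v); last first.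
    by case: eqP => // ->.
  congr (_ * _); case: (v \in A); rewrite t_homX /tab /= ?orbT ?orbF.
    by rewrite (negPf (rNa v vD)).
  by case: eqP => // ->.
- move=> v; rewrite rmorphM /ucut in_setU1; case: (boolP (v \in D)) => vD.
    by rewrite rmorph0 !mul0r.
  rewrite t_homX {1}/tab /= (_ : (if v == a then Xu a else Xu v) = Xu v); last first.
    by case: eqP => // ->.
  congr (_ * _); case: (v \in A); rewrite t_homX /tab /= ?orbT ?orbF.
    by rewrite (negPf (rNa v vD)).
  by case: eqP => // ->.
- rewrite rmorphB !rmorphM !xy_homx !xy_homy (negPf aA) (negPf (NA a aND)).
  rewrite /ucut (negPf aND) (negPf (rhoP aND)).
  rewrite (_ : _ - _ = Xu a * Xu (rho a) * (Xs a * Xr (rho a) - Xs (rho a) * Xr a));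
    last by ring.
  by rewrite !mulf_neq0 ?tX_neq0 // tX_minor_neq0 // eq_sym.
- rewrite rmorphB !rmorphM !xy_homx !xy_homy !in_setU1 eqxx (negPf ra) /=.
  by rewrite (negPf (NA a aND)) mulrACA [X in X * _]mulrC mulrACA subrr.
Qed.

(** First set [r] to zero component by component, which kills the [y] variables, then set [u] to
    zero vertex by vertex outside [D], which kills the [x] variables. *)
Lemma chain_above : exists P1, chain_from_to component_prime P1 (#|reps| + #|~: D|).
Proof.
pose F (A : {set V}) := ker (param (ucut D) (Xs \o rho)
  (fun v => if rho v \in A then 0 else Xr (rho v))).
pose F' (A : {set V}) := ker (param (ucut (D :|: A)) (Xs \o rho) (fun=> 0)).
exists (F' (~: D)); apply: chain_cat (_ : chain_from_to _ (F reps) _) _.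
  have -> : component_prime = F finset.set0.
    by apply: param_ker_eq => v //=; rewrite inE.
  apply: (@chain_sets _ _ _ F) => [A|A a AD aD aA]; first exact: ker_prime.
  move: aD; rewrite !inE => /andP[aD /eqP ra].
  apply: (@param_ker_lt _ _ _ _ _ _ (tsubst (lift ord0 (lift ord0 ord0), a) 0) (y a)).
  - move=> v; rewrite rmorphM /ucut; case: (v \in D); first by rewrite rmorph0 !mul0r.
    by rewrite !t_homX.
  - move=> v; rewrite rmorphM /ucut; case: (v \in D); first by rewrite rmorph0 !mul0r.
    rewrite t_homX /tsubst /= in_setU1; congr (_ * _).
    by case: (rho v \in A); rewrite ?rmorph0 ?orbT // t_homX xpair_eqE /= orbF.
  - by rewrite xy_homy ra /ucut (negPf aD) (negPf aA) mulf_neq0 ?tX_neq0.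
  - by rewrite xy_homy ra setU11 mulr0.
have -> : F reps = F' finset.set0.
  apply: param_ker_eq => v; rewrite /ucut finset.setU0 //.
  case: (boolP (v \in D)) => vD; first by rewrite !mul0r.
  by rewrite !inE rhoP // rhoK // eqxx.
apply: (@chain_sets _ _ _ F') => [A|A a AD aD aA]; first exact: ker_prime.
move: aD; rewrite !inE => aD.
apply: (@param_ker_lt _ _ _ _ _ _ (tsubst (0, a) 0) (x a)).
- move=> v; rewrite rmorphM /ucut finset.setUCA in_setU1 t_homX.
  case: (v \in D :|: A); first by rewrite orbT rmorph0 !mul0r.
  by rewrite t_homX orbF /tsubst xpair_eqE /=; case: (v == a).
- by move=> v; rewrite rmorphM rmorph0 !mulr0.
- by rewrite xy_homx /ucut inE (negPf aD) (negPf aA) mulf_neq0 ?tX_neq0.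
- by rewrite xy_homx /ucut finset.setUCA setU11 mul0r.
Qed.

(** The chains below and above have total length [#|V| + #|V|], the number of variables, so
    [has_height_chains] applies. *)
Lemma component_prime_height :
  has_height component_prime (#|V| + #|D| - #|reps|).
Proof.
have [P1 above] := chain_above.
have cV := cardsC D; have cR := cardsID reps (~: D).
rewrite (_ : _ - _ = #|D| + #|D| + #|~: D :\: reps|)%N; last first.
  move: cR; rewrite (finset.setIidPr _); first by lia.
  by apply/fintype.subsetP => v; rewrite !inE => /andP[].
apply: has_height_chains chain_below above _.
move: cR; rewrite (finset.setIidPr _); first by lia.
by apply/fintype.subsetP => v; rewrite !inE => /andP[].
Qed.
Lemma component_primeP : prime_ideal component_prime.
Proof. exact: ker_prime. Qed.

Lemma component_prime_x v : component_prime (x v) <-> v \in D.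
Proof.
rewrite /component_prime /ker xy_homx /ucut; split=> [/eqP|->]; last by rewrite mul0r.
by apply: contraLR => /negPf->; rewrite mulf_neq0 ?tX_neq0.
Qed.

Lemma component_prime_y v : v \in D -> component_prime (y v).
Proof. by rewrite /component_prime /ker xy_homy /ucut => ->; rewrite mul0r. Qed.

Lemma component_prime_minor v w : v \notin D -> w \notin D ->
  component_prime (x v * y w - x w * y v) <-> rho v = rho w.
Proof.
move=> vD wD; rewrite /component_prime /ker rmorphB !rmorphM !xy_homx !xy_homy.
rewrite /ucut (negPf vD) (negPf wD) /=.
rewrite (_ : _ - _ = Xu v * Xu w * (Xs (rho v) * Xr (rho w) - Xs (rho w) * Xr (rho v)));
  last by ring.
split=> [/eqP|->]; last by rewrite subrr mulr0.
by apply: contraTeq => /tX_minor_neq0 vw; rewrite !mulf_neq0 ?tX_neq0.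
Qed.

(* The components map to the points [(eta x : eta y)] of a projective line (or to
   [0]), which gives a specialization [theta] of the parametrization to [eta]. *)
Lemma component_prime_sub (L : fieldType) (eta : {rmorphism S -> L}) :
  (forall v, v \in D -> eta (x v) = 0 /\ eta (y v) = 0) ->
  (forall v w, v \notin D -> w \notin D -> rho v = rho w ->
     eta (x v * y w - x w * y v) = 0) ->
  (component_prime `<=` ker eta)%classic.
Proof.
move=> eD eM.
(* The point of a class [c] is read off a vertex [w] whose column is nonzero; [la v] is the ratio of
   column [v] to it, computed in a nonzero coordinate. *)
pose nz c w := [&& w \notin D, rho w == c & (eta (x w) != 0) || (eta (y w) != 0)].
pose al c := if [pick w | nz c w] is Some w then eta (x w) else 0.
pose be c := if [pick w | nz c w] is Some w then eta (y w) else 0.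
pose la v := if al (rho v) != 0 then eta (x v) / al (rho v)
  else eta (y v) / be (rho v).
have laP v : v \notin D -> la v * al (rho v) = eta (x v) /\
    la v * be (rho v) = eta (y v).
  move=> vD; rewrite /la /al /be; case: pickP => [w /and3P[wD /eqP rw nzw]|none].
    have := eM v w vD wD (esym rw); rewrite rmorphB !rmorphM => /eqP.
    rewrite subr_eq0 => /eqP m; case: (eqVneq (eta (x w)) 0) nzw => [xw0 /= yw|xw _].
      rewrite xw0 mul0r in m; rewrite xw0 mulr0 mulfVK //; split=> //; apply/esym/eqP.
      by move/eqP: m; rewrite mulf_eq0 (negPf yw) orbF.
    by rewrite mulfVK //; split=> //; rewrite mulrAC m mulrC mulKf.
  have := none v; rewrite /nz vD eqxx /= => /norP.
  by rewrite !negbK => -[/eqP-> /eqP->]; rewrite !mulr0.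
pose theta := t_hom (eta \o @mpolyC (#|V| + #|V|) K)
  (fun k : tvar => if k.1 == 0 then la k.2 else if k.1 == 1 then al k.2 else be k.2).
apply: (@param_ker_sub _ _ _ _ _ theta) => [c|v|v].
- by rewrite t_homC.
- rewrite rmorphM /ucut; case: ifP => [/eD[-> _]|/negbT/laP[<- _]].
    by rewrite rmorph0 mul0r.
  by rewrite /= !t_homX.
- rewrite rmorphM /ucut; case: ifP => [/eD[_ ->]|/negbT/laP[_ <-]].
    by rewrite rmorph0 mul0r.
  by rewrite /= !t_homX.
Qed.

End Parametrization.

(** * Minimal primes of binomial edge ideals *)

Section MinimalPrimes.
Variables (K : fieldType) (G : sgraph).
Local Notation S := (bei_ring K G).
Local Notation J := (@binomial_edge_ideal K G).
Local Notation x := (@bei_x K G).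
Local Notation y := (@bei_y K G).
Implicit Types (T : {set G}) (u v w : G).

Definition minor v w : S := x v * y w - x w * y v.

Definition cut_prime T : set S := @component_prime K G T (ccroot (~: T)).

Lemma ccroot_notin T v : v \notin T -> ccroot (~: T) v \notin T.
Proof. by rewrite -!finset.in_setC; apply: ccroot_mem. Qed.

Lemma cut_primeP T : prime_ideal (cut_prime T). Proof. exact: component_primeP. Qed.

Lemma cut_prime_x T v : cut_prime T (x v) <-> v \in T.
Proof. exact: component_prime_x. Qed.

Lemma cut_prime_minor T v w : v \notin T -> w \notin T ->
  cut_prime T (minor v w) <-> conn (~: T) v w.
Proof.
move=> vT wT; apply: (iff_trans (component_prime_minor K _ vT wT)).
by split=> [/ccrootP|/ccrootP].
Qed.

Lemma cut_prime_height T :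
  has_height (cut_prime T) (#|G| + #|T| - c_del T).
Proof.
rewrite c_delE; apply: component_prime_height => v.
  exact: ccroot_notin.
by move=> _; apply: ccrootK.
Qed.

(** Minors are antisymmetric, so the orientation of edges by [enum_rank] is harmless. *)
Lemma bei_sub_ker (L : nzRingType) (f : {rmorphism S -> L}) :
  (J `<=` ker f)%classic <-> forall v w, sedge v w -> f (minor v w) = 0.
Proof.
split=> [Jf|fE].
  have lt v w : sedge v w -> (enum_rank v < enum_rank w)%N -> f (minor v w) = 0.
    move=> vw lt_vw; apply: Jf; exists (fun v' w' => ((v' == v) && (w' == w))%:R).
    rewrite (bigD1 v) //= (bigD1 w) ?vw //= !eqxx mul1r big1 ?addr0 => [|w' /andP[_]].
      by rewrite big1 ?addr0 // => v' /negPf v'v; rewrite big1 // => w' _; rewrite v'v mul0r.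
    by move=> /negPf->; rewrite mul0r.
  move=> v w vw; case: (ltngtP (enum_rank v) (enum_rank w)) => [||/ord_inj/enum_rank_inj e].
  - exact: lt.
  - rewrite /minor -opprB rmorphN => /lt -> //; first by rewrite oppr0.
    by rewrite sedge_sym.
  - by rewrite e sedge_irrefl in vw.
move=> _ [a ->]; rewrite /ker rmorph_sum big1 // => v _.
rewrite rmorph_sum big1 // => w /andP[vw _].
by rewrite rmorphM -[edge_binomial _ _ _]/(minor v w) fE ?mulr0.
Qed.

(** The matrix with columns [(f (x v), f (y v))] is zero on [T] and has rank at most one on each
    component of [G \ T]. *)
Definition rank1_off (L : nzRingType) (f : S -> L) T : Prop :=
  (forall v, v \in T -> f (x v) = 0 /\ f (y v) = 0) /\
  (forall v w, v \notin T -> w \notin T -> conn (~: T) v w -> f (minor v w) = 0).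

Lemma cut_prime_sub (L : fieldType) (f : {rmorphism S -> L}) T :
  rank1_off f T -> (cut_prime T `<=` ker f)%classic.
Proof.
move=> [f0 fm]; apply: component_prime_sub => // v w vT wT /ccrootP.
exact: fm.
Qed.

Lemma bei_sub_cut_prime T : (J `<=` cut_prime T)%classic.
Proof.
apply/bei_sub_ker => v w vw; have [vT|vT] := boolP (v \in T).
  rewrite rmorphB !rmorphM (proj2 (cut_prime_x T v) vT).
  by rewrite (component_prime_y K _ vT) mul0r mulr0 subr0.
have [wT|wT] := boolP (w \in T).
  rewrite rmorphB !rmorphM (proj2 (cut_prime_x T w) wT).
  by rewrite (component_prime_y K _ wT) mul0r mulr0 subr0.
by apply/cut_prime_minor => //; apply: conn_edge; rewrite ?finset.in_setC.
Qed.

(** Proportionality passes through a nonzero column: each entry of column [v] times the minor of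
    [u], [w] is a combination of the other two minors. *)
Lemma minor_trans (L : idomainType) (f : {rmorphism S -> L}) u v w :
  f (x v) != 0 \/ f (y v) != 0 ->
  f (minor u v) = 0 -> f (minor v w) = 0 -> f (minor u w) = 0.
Proof.
rewrite /minor !rmorphB !rmorphM => nz uv vw.
have ey : f (y v) * (f (x u) * f (y w) - f (x w) * f (y u)) = 0.
  rewrite (_ : _ * _ = (f (x u) * f (y v) - f (x v) * f (y u)) * f (y w) +
    (f (x v) * f (y w) - f (x w) * f (y v)) * f (y u)); last by ring.
  by rewrite uv vw !mul0r addr0.
have ex : f (x v) * (f (x u) * f (y w) - f (x w) * f (y u)) = 0.
  rewrite (_ : _ * _ = (f (x u) * f (y v) - f (x v) * f (y u)) * f (x w) +
    (f (x v) * f (y w) - f (x w) * f (y v)) * f (x u)); last by ring.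
  by rewrite uv vw !mul0r addr0.
by case: nz => nz; apply: (mulfI nz); rewrite mulr0.
Qed.

(** Outside the set of zero columns every column on a path is nonzero, so [minor_trans] propagates
    proportionality. *)
Lemma rank1_off_vanishing (L : idomainType) (f : {rmorphism S -> L}) :
  (J `<=` ker f)%classic ->
  rank1_off f [set v | (f (x v) == 0) && (f (y v) == 0)].
Proof.
move=> /bei_sub_ker fE; split=> [v|u w].
  by rewrite inE => /andP[/eqP-> /eqP->].
set T := [set v | _] => uT wT.
have nz v : v \in ~: T -> f (x v) != 0 \/ f (y v) != 0.
  by rewrite !inE negb_and => /orP.
move=> uw; pose P : pred G := fun v => (v \in ~: T) && (f (minor u v) == 0).
suff /andP[_ /eqP//] : w \in P.
apply: (erel_closed _ uw) => [a b aT bT ab|].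
  move=> /andP[_ /eqP ua]; apply/andP; split=> //.
  by apply/eqP; apply: minor_trans (nz a aT) ua (fE _ _ ab).
by apply/andP; rewrite finset.in_setC uT /minor subrr rmorph0.
Qed.

(** If [T] is not a cutset, some [v] in [T] joins no two components of [G \ T] and can be put back:
    its column is zero, and connectivity between the other vertices is unchanged by [conn_setU1]. *)
Lemma rank1_off_minimal_cutset (L : nzRingType) (f : {rmorphism S -> L}) T :
  rank1_off f T -> exists2 T', cutset T' & rank1_off f T'.
Proof.
move: {2}_.+1 (ltnSn #|T|) => n; elim: n T => // n IHn T Tn [f0 fm].
have [cT|ncT] := boolP (cutset T); first by exists T.
have [v vT nv] : exists2 v, v \in T &
    ~ exists u w, [/\ u \notin T, w \notin T, sedge v u, sedge v w & ~~ conn (~: T) u w].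
  apply: contrapT => none; case/negP: ncT; apply/cutsetP => v vT.
  by apply: contrapT => nv; apply: none; exists v.
apply: (IHn (T :\ v)%SET).
  by rewrite ltnS in Tn; apply: leq_trans Tn; rewrite [X in (_ <= X)%N](cardsD1 v) vT.
split=> [w /finset.setD1P[_ /f0] //|a b aT bT ab].
have E : (~: (T :\ v) = v |: ~: T)%SET by rewrite finset.setCD finset.setUC.
have vz : f (x v) = 0 /\ f (y v) = 0 by apply: f0.
have [->|av] := eqVneq a v.
  by rewrite rmorphB !rmorphM vz.1 vz.2 mul0r mulr0 subr0.
have [->|bv] := eqVneq b v.
  by rewrite rmorphB !rmorphM vz.1 vz.2 mul0r mulr0 subr0.
have {}aT : a \notin T by move: aT; rewrite !inE av.
have {}bT : b \notin T by move: bT; rewrite !inE bv.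
apply: fm => //; rewrite E in ab.
have vN : v \notin (~: T)%SET by rewrite finset.in_setC vT.
apply: (conn_setU1 vN _ _ _ ab); rewrite ?finset.in_setC // => u w.
rewrite !finset.in_setC => uT wT vu vw; apply: contrapT => /negP uw.
by apply: nv; exists u, w.
Qed.

Lemma prime_above_bei (Q : set S) : prime_ideal Q -> (J `<=` Q)%classic ->
  exists2 T, cutset T & (cut_prime T `<=` Q)%classic.
Proof.
move=> /prime_ideal_ker[L [f Qf]] JQ.
have [|T cT fT] := @rank1_off_minimal_cutset _ f _ (@rank1_off_vanishing _ f _).
  by move=> a /JQ /Qf.
by exists T => // a /(cut_prime_sub fT) /Qf.
Qed.

(** The variables [x v] in the primes give [T' \subset T]. If [v] were in [T] but not in [T'], two
    neighbours of [v] separated by [T] would be joined through [v] off [T'], and their minor would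
    lie in [cut_prime T'] only. *)
Lemma cut_prime_inj T T' : cutset T -> (cut_prime T' `<=` cut_prime T)%classic -> T' = T.
Proof.
move=> /cutsetP cT sTT'.
have sT : T' \subset T.
  by apply/fintype.subsetP => v /cut_prime_x/sTT'/cut_prime_x.
apply/eqP; rewrite finset.eqEsubset sT /=; apply/fintype.subsetP => v /[dup] vT /cT.
case=> u [w [uT wT vu vw nuw]]; apply: contraNT nuw => vT'.
have nT' z : z \notin T -> z \notin T'
  by apply: contra => /(fintype.subsetP sT).
apply/(cut_prime_minor uT wT)/sTT'/cut_prime_minor; rewrite ?nT' //.
apply: (@conn_trans _ _ v); last by apply: conn_edge; rewrite ?finset.in_setC ?vT' ?nT' //.
by rewrite conn_sym; apply: conn_edge; rewrite ?finset.in_setC ?vT' ?nT'.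
Qed.

Lemma minimal_prime_bei (P : set S) :
  minimal_prime J P <-> exists2 T, cutset T & P = cut_prime T.
Proof.
split=> [[pP JP minP]|[T cT ->]].
  have [T cT TP] := prime_above_bei pP JP; exists T => //; apply/esym.
  by apply: minP => //; [apply: cut_primeP|apply: bei_sub_cut_prime].
split=> [||Q pQ JQ QT]; [exact: cut_primeP|exact: bei_sub_cut_prime|].
have [T' cT' T'Q] := prime_above_bei pQ JQ; apply/seteqP; split=> //.
by rewrite -(cut_prime_inj cT (subset_trans T'Q QT)).
Qed.

Lemma has_height_inj (R : comNzRingType) (P : set R) h k :
  has_height P h -> has_height P k -> h = k.
Proof.
by move=> [ch hmax] [ck kmax]; apply/eqP; rewrite eqn_leq kmax // hmax.
Qed.

Lemma cutset0 : cutset (finset.set0 : {set G}).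
Proof. by apply/forall_inP => v; rewrite inE. Qed.

Lemma c_del_leq T : (c_del T + #|T| <= #|G|)%N.
Proof.
rewrite c_delE addnC -(cardsC T) leq_add2l subset_leq_card //.
by apply/fintype.subsetP => v; rewrite inE => /andP[].
Qed.

(** Every height is compared with that of the prime of the empty cutset. The bound [c_del_leq] keeps
    the natural subtractions from truncating. *)
Lemma unmixed_bei : unmixed J <->
  forall T, cutset T -> c_del T = (#|T| + c_del (finset.set0 : {set G}))%N.
Proof.
have c0 := c_del_leq finset.set0; rewrite cards0 addn0 in c0.
split=> [uJ T cT|cE P Q].
  have mT T' : cutset T' -> minimal_prime J (cut_prime T').
    by move=> cT'; apply/minimal_prime_bei; exists T'.
  have := (uJ _ _ (mT T cT) (mT _ cutset0) _).1 (cut_prime_height T).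
  move=> /(has_height_inj (cut_prime_height finset.set0)).
  by have := c_del_leq T; rewrite cards0; lia.
move=> /minimal_prime_bei[T cT ->] /minimal_prime_bei[T' cT' ->] h.
have hE T'' : cutset T'' ->
    has_height (cut_prime T'') (#|G| - c_del (finset.set0 : {set G})).
  move=> cT''; have := cut_prime_height T''; rewrite cE //.
  by rewrite (_ : _ + _ - _ = #|G| - c_del (finset.set0 : {set G}))%N //; lia.
by split=> /has_height_inj e; [rewrite (e _ (hE T cT))|rewrite (e _ (hE T' cT'))];
  apply: hE.
Qed.

End MinimalPrimes.

Theorem proposition3p1 (K : fieldType) (G : sgraph) (B : {set G}) :
  connected G -> accessible K G -> block B -> accessible K (bar B).
Proof.
move=> connG [/unmixed_bei unmG accG] blockB; split.
  by apply/unmixed_bei => T; apply: bar_cutset_card.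
exact: bar_cutset_accessible.
Qed.
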